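(* Consider the Gamma family such that $\{z_i\}_{i=1}^m$ are independent with parameters $\{(\theta_i,\sigma)\}_{i=1}^m$ and a fixed $\sigma>0$. Let $\rho>0$ be a finite constant. If $\sigma>3/4$, then a uniform consistency class is $$\mathcal Q_{\mathrm{III}}(\boldsymbol\theta,t,\pi_{1,m};\gamma)=\left\{\begin{array}{c}\|\boldsymbol\theta\|_\infty\le\rho,\ t=4^{-1}\gamma u_{3,m}\ln m,\ \lim_{m\to\infty}u_{3,m}\ln m=\infty,\\ \pi_{1,m}\ge m^{(\gamma-1)/2},\ \lim_{m\to\infty}t\min_{i\in I_{1,m}}|\xi(\theta_0)-\xi(\theta_i)|=\infty\end{array}\right\}$$ for any fixed $\gamma\in(0,1]$. On the other hand, if $\sigma\le3/4$, then a uniform consistency class is $$\mathcal Q_{\mathrm{III}}(\boldsymbol\theta,t,\pi_{1,m};\gamma)=\left\{\begin{array}{c}\|\boldsymbol\theta\|_\infty\le\rho,\ t=4^{-1}\gamma u_{3,m}\ln m,\ \pi_{1,m}\ge m^{(\gamma'-1)/2},\\ \lim_{m\to\infty}t\min_{i\in I_{1,m}}|\xi(\theta_0)-\xi(\theta_i)|=\infty\end{array}\right\}$$ for any fixed $\gamma\in(0,1)$ and $\gamma'>\gamma$. In either case, the speed of convergence is poly-log.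
   Context: The Gamma family with parameters $(\theta,\sigma)$, $\theta<1$, $\sigma>0$, has distributions $G_\theta$ with density $f_\theta(x)=(1-\theta)^\sigma\frac{e^{\theta x}x^{\sigma-1}e^{-x}}{\Gamma(\sigma)}1_{(0,\infty)}(x)$, where $\Gamma$ is Euler's Gamma function. $z_i$ has distribution $G_{\theta_i}$; $\theta_0<1$ is fixed; $\mathbf z=(z_1,\dots,z_m)$, $\boldsymbol\theta=(\theta_1,\dots,\theta_m)$, $\|\cdot\|_\infty$ is the maximum norm. $u_{3,m}=\min_{1\le i\le m}\{1-\theta_i\}$, $\xi(\theta)=(1-\theta)^{-1}$, $I_{1,m}=\{1\le i\le m:\theta_i\ne\theta_0\}$, $\pi_{1,m}=|I_{1,m}|/m$. $\omega:[-1,1]\to\mathbb{R}$ is admissible (non-negative, bounded, $\int_{[-1,1]}\omega(s)ds=1$), and $$K(t,x;\theta_0)=\int_{[-1,1]}\omega(s)\sum_{n=0}^\infty\frac{(-tsx)^n\,\Gamma(\sigma)\cos\left(\frac\pi2n+\frac{ts}{1-\theta_0}\right)}{n!\,\Gamma(\sigma+n)}ds,\qquad\hat\varphi_m(t,\mathbf z)=\frac1m\sum_{i=1}^m\{1-K(t,z_i;\theta_0)\}.$$ $\hat\varphi_m(t,\mathbf z)$ is the estimator of $\pi_{1,m}$ to which the claim refers. Uniform consistency class: a sequence of sets $\mathcal Q_m$ of pairs (parameter vector $\boldsymbol\theta$, $t$), $m=1,2,\dots$, is called a uniform consistency class for $\hat\varphi_m(t,\mathbf z)$ if $$\Pr\left\{\sup_{\boldsymbol\theta\in\mathcal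 Q_m}\left|\pi_{1,m}^{-1}\sup_{t\in\mathcal Q_m}\hat\varphi_m(t,\mathbf z)-1\right|\to0\right\}\to1.$$ The ''speed of convergence'' of $\hat\varphi_m(t_m,\mathbf z)$ is the sequence $t=t_m\to\infty$ employed; ''poly-log'' means it is of the order of a power of $\ln m$.
   Formalization: Poly-log speed: t=O((ln m)^k) always, exact order only if u_{3,m} is bounded away from 0, t→∞ only for σ>3/4, since u_{3,m}=ln ln m/ln m gives t of order ln ln m. Consistency is convergence in probability uniform over θ, as the law of z depends on θ. *)

(* Defs.v *)
(* MathComp-Analysis, over an arbitrary [R : realType]. *)
From HB Require Import structures.
From mathcomp Require Export all_boot all_order all_algebra.
From mathcomp Require Export all_classical all_reals all_analysis.
Export Order.TTheory GRing.Theory Num.Theory numFieldNormedType.Exports.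

Set Implicit Arguments.
Unset Strict Implicit.
Unset Printing Implicit Defensive.

Local Open Scope classical_set_scope.
Local Open Scope ring_scope.

Definition Gamma {R : realType} (s : R) : R :=
  \int[lebesgue_measure]_(x in `]0, +oo[) (x `^ (s - 1) * expR (- x)).

Definition gamma_pdf {R : realType} (sigma theta x : R) : R :=
  (1 - theta) `^ sigma *
  (expR (theta * x) * x `^ (sigma - 1) * expR (- x) / Gamma sigma) *
  \1_(`]0, +oo[) x.

Definition mutually_independent {R : realType} {d : measure_display}
    {T : measurableType d} (P : probability T R) (m : nat)
    (z : 'I_m -> {RV P >-> R}) : Prop :=
  forall B : 'I_m -> set R, (forall i, measurable (B i)) ->
    P [set w | forall i, B i (z i w)] = (\prod_(i < m) P (z i @^-1` B i))%E.

Definition gamma_sample {R : realType} {d : measure_display}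
    {T : measurableType d} (P : probability T R) (m : nat) (sigma : R)
    (theta : 'rV[R]_m) (z : 'I_m -> {RV P >-> R}) : Prop :=
  mutually_independent z /\
  forall (i : 'I_m) (A : set R), measurable A ->
    distribution P (z i) A =
    (\int[lebesgue_measure]_(x in A) (gamma_pdf sigma (theta 0 i) x)%:E)%E.

(* Only the values of [omega] on [-1, 1] are ever used. *)
Definition admissible {R : realType} (omega : R -> R) : Prop :=
  [/\ measurable_fun `[(-1 : R), 1] omega,
      forall s, s \in `[-1, 1] -> 0 <= omega s,
      exists M : R, forall s, s \in `[-1, 1] -> `|omega s| <= M
    & (\int[lebesgue_measure]_(s in `[(-1 : R)%R, 1%R]) (omega s)%:E = 1)%E].

Section estimator.
Context {R : realType}.

Definition K_term (sigma theta0 t x s : R) (n : nat) : R :=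
  (- (t * s * x)) ^+ n * Gamma sigma *
    cos (pi / 2 * n%:R + t * s / (1 - theta0)) /
  (n`!%:R * Gamma (sigma + n%:R)).

Definition K (sigma theta0 : R) (omega : R -> R) (t x : R) : R :=
  \int[lebesgue_measure]_(s in `[(-1 : R), 1])
    (omega s * limn (series (K_term sigma theta0 t x s))).

Definition phihat (sigma theta0 : R) (omega : R -> R) (m : nat) (t : R)
    (z : 'I_m -> R) : R :=
  m%:R^-1 * \sum_(i < m) (1 - K sigma theta0 omega t (z i)).

Definition xi (theta : R) : R := (1 - theta)^-1.

Definition I1 (theta0 : R) (m : nat) (theta : 'rV[R]_m) : {set 'I_m} :=
  [set i | theta 0 i != theta0]%SET.

Definition pi1 (theta0 : R) (m : nat) (theta : 'rV[R]_m) : R :=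
  #|I1 theta0 theta|%:R / m%:R.

Definition u3 (n : nat) (theta : 'rV[R]_n.+1) : R :=
  \big[Num.min/(1 - theta 0 ord0)]_(i < n.+1) (1 - theta 0 i).

(* The minimum over the empty set is [+oo]; [I1] is nonempty as soon as
   [pi1 > 0]. *)
Definition min_sep (theta0 : R) (m : nat) (theta : 'rV[R]_m) : \bar R :=
  \big[Order.min/+oo%E]_(i in I1 theta0 theta)
    `|xi theta0 - xi (theta 0 i)|%:E.

End estimator.

(* A sequence of sets of pairs (theta, t).  The sample size is m = n.+1, so
   that the minimum [u3] and the proportion [pi1] always make sense. *)
Definition set_seq (R : realType) : Type := forall n : nat, set ('rV[R]_n.+1 * R).

Definition lnm {R : realType} (n : nat) : R := ln n.+1%:R.

(* lim_m f = +oo along a sequence of sets: uniformly over the members of the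
   sets.  When every set is a singleton this is the limit along a sequence of
   parameters. *)
Definition diverges_on {R : realType} (Q : set_seq R)
    (f : forall n : nat, 'rV[R]_n.+1 -> R -> \bar R) : Prop :=
  forall M : R, \forall n \near \oo, forall (theta : 'rV[R]_n.+1) (t : R),
    Q n (theta, t) -> (M%:E <= f n theta t)%E.

(* The law of the sample depends on theta, hence the supremum over theta is
   read as uniformity over theta of the convergence in probability to 0 of
   |pi1^-1 * sup_t phihat - 1|; for each theta, t ranges over the values that
   [Q n] pairs with theta. *)
Definition uniform_consistency_class {R : realType}
    (sigma theta0 : R) (omega : R -> R) (Q : set_seq R) : Prop :=
  forall eps delta : R, 0 < eps -> 0 < delta ->
  \forall n \near \oo, forall theta : 'rV[R]_n.+1,
    (exists t, Q n (theta, t)) ->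
    forall (d : measure_display) (T : measurableType d) (P : probability T R)
      (z : 'I_n.+1 -> {RV P >-> R}),
    gamma_sample sigma theta z ->
    ((1 - delta)%:E <=
     P [set w | (`|(pi1 theta0 theta)^-1%:E *
                   ereal_sup [set (phihat sigma theta0 omega t
                                     (fun i => z i w))%:E
                             | t in [set t | Q n (theta, t)]] - 1|
                 <= eps%:E)%E])%E.

(* For any gamma' : conditions common to both versions of the class; the
   parameter space of the family is theta_i < 1.  The version for
   sigma > 3/4 has gamma' = gamma. *)
Definition QIII_base {R : realType} (theta0 rho gamma gamma' : R)
    (Q : set_seq R) : Prop :=
  (forall (n : nat) (theta : 'rV[R]_n.+1) (t : R), Q n (theta, t) ->
     [/\ forall i, theta 0 i < 1,
         `|theta| <= rho,
         t = 4^-1 * gamma * u3 theta * lnm n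
       & pi1 theta0 theta >= n.+1%:R `^ ((gamma' - 1) / 2)]) /\
  diverges_on Q (fun n theta t => t%:E * min_sep theta0 theta)%E.

Definition QIII_large_sigma {R : realType} (theta0 rho gamma : R)
    (Q : set_seq R) : Prop :=
  QIII_base theta0 rho gamma gamma Q /\
  diverges_on Q (fun n theta t => (u3 theta * lnm n)%:E).

Definition QIII_small_sigma {R : realType} (theta0 rho gamma gamma' : R)
    (Q : set_seq R) : Prop :=
  QIII_base theta0 rho gamma gamma' Q.

(* t is at most of the order of (ln m)^k, and of that exact order when the
   u_{3,m} are bounded away from 0.  No power of ln m bounds t from below in
   general, since u_{3,m} may tend to 0, e.g. like (ln ln m) / (ln m). *)
Definition poly_log_speed {R : realType} (Q : set_seq R) : Prop :=
  exists2 k : R, 0 < k &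
    (exists2 C : R, 0 < C & \forall n \near \oo,
       forall (theta : 'rV[R]_n.+1) (t : R), Q n (theta, t) ->
         `|t| <= C * lnm n `^ k) /\
    ((exists2 u : R, 0 < u & forall (n : nat) (theta : 'rV[R]_n.+1) (t : R),
        Q n (theta, t) -> u <= u3 theta) ->
     exists2 c : R, 0 < c & \forall n \near \oo,
       forall (theta : 'rV[R]_n.+1) (t : R), Q n (theta, t) ->
         c * lnm n `^ k <= t).

(* Main.v *)
Require Import Defs.
From mathcomp Require Import ring lra measurable_realfun.

(** The kernel turns a Gamma variable into a cosine.  As a power series in x,
    [K t x] has an n-th coefficient carrying the factor 1 / (sigma)_n, and the
    n-th moment of the Gamma law with parameter theta is
    (sigma)_n / (1 - theta) ^ n ([gamma_law_moment]).  In the expectation the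
    rising factorials cancel and the Taylor series of a cosine remains, so that
    [K t (z i)] has mean
      cos_transform omega (t * (xi theta0 - xi (theta i)))
    ([K_expectation]).  This is 1 if theta i = theta0; otherwise it is small
    once t * |xi theta0 - xi (theta i)| is large, by the Riemann-Lebesgue lemma
    ([riemann_lebesgue]).  Hence [phihat] has mean pi1 * (1 + o(1)), uniformly
    over the class.

    The fluctuation is controlled by a second moment.  In absolute value
    [K t x] is at most H (|t| |x|) with H y = sum_n y ^ n / (n! (sigma)_n), and
    the second moment of H (|t| |z|) is the sum over n of
    [moment_coef sigma n] * (4 tau) ^ n / n! with tau = |t| / (1 - theta)
    ([second_moment_bound]).  The Chu-Vandermonde identity gives
    [moment_coef sigma n] in closed form, of order n ^ (1/2 - sigma).  It
    therefore tends to 0 if sigma > 3/4, and for every sigma it does so after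
    division by p ^ n, for any p > 1.  In both cases an Abelian argument
    ([exp_series_little_o]) makes the second moment o(exp (4 p tau)), where
    p = gamma' / gamma and p = 1 is the case of large sigma.

    The choice t = gamma / 4 * u3 * ln m means 4 tau <= gamma * ln m for every
    observation, so [phihat] has variance o(m ^ (gamma' - 1)) by independence,
    whereas pi1 ^ 2 >= m ^ (gamma' - 1).  The Chebyshev inequality
    ([chebyshev_sum]) concludes.

    The total mass 1 of the law of an observation fixes the normalising
    constant of the Gamma density, and integration by parts relates all moments
    to it. *)

Set Implicit Arguments.
Unset Strict Implicit.
Unset Printing Implicit Defensive.

Local Open Scope classical_set_scope.
Local Open Scope ring_scope.

(** * Rising factorials and the coefficients of the second moment *)

Definition rising {R : realType} (s : R) (n : nat) : R := \prod_(j < n) (s + j%:R).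

(** The generalised binomial coefficient, x over n. *)
Definition gbin {R : realType} (x : R) (n : nat) : R :=
  (\prod_(j < n) (x - j%:R)) / n`!%:R.

(** The coefficients of the hypergeometric series 0F1(; s; y), which dominates
    the kernel. *)
Definition hyp_coef {R : realType} (s : R) (n : nat) : R :=
  (n`!%:R * rising s n)^-1.

Definition hyp_sqr_coef {R : realType} (s : R) (n : nat) : R :=
  \sum_(k < n.+1) hyp_coef s k * hyp_coef s (n - k).

Section coefficients.
Context {R : realType}.
Implicit Types (x y s : R) (n : nat).

Lemma rising0 s : rising s 0 = 1.
Proof. by rewrite /rising big_ord0. Qed.

Lemma risingS s n : rising s n.+1 = rising s n * (s + n%:R).
Proof. by rewrite /rising big_ord_recr. Qed.

Lemma rising_gt0 s n : 0 < s -> 0 < rising s n.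
Proof.
by move=> s0; apply: prodr_gt0 => i _; rewrite ltr_wpDr ?ler0n.
Qed.

Lemma hyp_coef_gt0 s n : 0 < s -> 0 < hyp_coef s n.
Proof.
by move=> s0; rewrite invr_gt0 mulr_gt0 ?rising_gt0// ltr0n fact_gt0.
Qed.

Lemma gbin0 x : gbin x 0 = 1.
Proof. by rewrite /gbin big_ord0 fact0 divr1. Qed.

Lemma gbinS x n : n.+1%:R * gbin x n.+1 = (x - n%:R) * gbin x n.
Proof.
rewrite /gbin big_ord_recr/= factS natrM invfM.
have ? : n.+1%:R != 0 :> R by rewrite pnatr_eq0.
have ? : n`!%:R != 0 :> R by rewrite pnatr_eq0 -lt0n fact_gt0.
by field; apply/andP; split=> //; rewrite addrC natr1.
Qed.

(** The Chu-Vandermonde identity.  Writing the factor n + 1 of the recursion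
    [gbinS] as k + (n + 1 - k) splits the convolution into two parts, and
    [gbinS] lowers one index in each of them; the two factors that come out,
    x - k and y - (n - k), add up to x + y - n. *)
Lemma vandermonde x y n :
  \sum_(k < n.+1) gbin x k * gbin y (n - k) = gbin (x + y) n.
Proof.
elim: n => [|n IH]; first by rewrite big_ord1 !gbin0 mulr1.
have n0 : n.+1%:R != 0 :> R by rewrite pnatr_eq0.
apply: (mulfI n0); rewrite gbinS -IH big_distrr/=.
rewrite (eq_bigr (fun k : 'I_n.+2 =>
   k%:R * gbin x k * gbin y (n.+1 - k) +
   gbin x k * ((n.+1 - k)%N%:R * gbin y (n.+1 - k)))); last first.
  move=> k _; have kn : (k <= n.+1)%N by rewrite -ltnS.
  rewrite [in LHS](_ : n.+1%:R = k%:R + (n.+1 - k)%:R); first by ring.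
  by rewrite -natrD subnKC.
rewrite big_split/= big_ord_recl/= !mul0r add0r.
rewrite [X in _ + X]big_ord_recr/= subnn mul0r mulr0 addr0 -big_split/= big_distrr/=.
apply: eq_bigr => k _; have kn : (k <= n)%N by rewrite -ltnS.
rewrite /bump/= add1n subSS gbinS subSn// gbinS natrB//; ring.
Qed.

(** With upper argument s + n - 1 the falling product consists of the last k
    factors of [rising s n].  This turns [vandermonde] into a formula for the
    convolution of [hyp_coef] with itself. *)
Lemma gbin_rising s n k : 0 < s -> (k <= n)%N ->
  gbin (s + n%:R - 1) k = rising s n / rising s (n - k) / k`!%:R.
Proof.
move=> s0 kn; rewrite /gbin; congr (_ / _).
elim: k kn => [_|k IH kn].
  by rewrite big_ord0 subn0 divff// gt_eqF// rising_gt0.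
rewrite big_ord_recr/= IH ?(ltnW kn)//.
rewrite [in LHS](_ : (n - k = (n - k.+1).+1)%N); last by rewrite subnSK.
rewrite risingS natrB// -natr1.
have := rising_gt0 (n - k.+1) s0; move: (rising s (n - k.+1)) => r r0.
have : 0 < s + (n%:R - (k%:R + 1)).
  by rewrite ltr_wpDr// natr1 -natrB// ler0n.
by move=> h; field; rewrite !gt_eqF//.
Qed.

Lemma hyp_sqr_coefE s n : 0 < s ->
  hyp_sqr_coef s n * rising s n ^+ 2 = gbin (s *+ 2 + n%:R *+ 2 - 2) n.
Proof.
move=> s0; rewrite (_ : _ - 2 = (s + n%:R - 1) + (s + n%:R - 1)); last by ring.
rewrite -vandermonde /hyp_sqr_coef mulr_suml; apply: eq_bigr => k _.
have kn : (k <= n)%N by rewrite -ltnS.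
rewrite !gbin_rising ?leq_subr// subKn// /hyp_coef !invfM expr2; ring.
Qed.

Lemma gbin_head x n : n.+1%:R * gbin (x + 1) n.+1 = (x + 1) * gbin x n.
Proof.
rewrite /gbin big_ord_recl/= subr0 factS natrM invfM.
have -> : \prod_(i < n) (x + 1 - (bump 0 i)%:R) = \prod_(i < n) (x - i%:R).
  by apply: eq_bigr => i _; rewrite /bump/= add1n -natr1; ring.
have ? : n.+1%:R != 0 :> R by rewrite pnatr_eq0.
have ? : n`!%:R != 0 :> R by rewrite pnatr_eq0 -lt0n fact_gt0.
by field; apply/andP; split=> //; rewrite addrC natr1.
Qed.

(** The normalisation by 4 ^ n removes the exponential growth: for s = 1 the
    numerator is the central binomial coefficient 'C(2n, n). *)
Definition moment_coef s n : R := n`!%:R * rising s n * hyp_sqr_coef s n / 4 ^+ n.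

Lemma moment_coef_ge0 s n : 0 < s -> 0 <= moment_coef s n.
Proof.
move=> s0; rewrite divr_ge0 ?exprn_ge0//.
rewrite mulr_ge0 ?mulr_ge0 ?ler0n ?(ltW (rising_gt0 _ _))//.
by rewrite /hyp_sqr_coef sumr_ge0// => k _; rewrite mulr_ge0// ltW// hyp_coef_gt0.
Qed.

Lemma moment_coef0 s : moment_coef s 0 = 1.
Proof.
by rewrite /moment_coef /hyp_sqr_coef big_ord1 /hyp_coef rising0 fact0
  !(mul1r,invr1,divr1).
Qed.

(** By the closed form of [hyp_sqr_coef] the sequence is hypergeometric.  Its
    ratio is 1 - (s - 1/2) / (n + 2s - 1), hence the order n ^ (1/2 - s). *)
Lemma moment_coefS s n : 0 < s ->
  moment_coef s n.+1 * (n%:R + s *+ 2 - 1) = moment_coef s n * (n%:R + s - 2^-1).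
Proof.
move=> s0.
have sq k : moment_coef s k * 4 ^+ k * rising s k =
    k`!%:R * gbin (s *+ 2 + k%:R *+ 2 - 2) k.
  by rewrite -hyp_sqr_coefE// /moment_coef mulfVK ?expf_neq0//; ring.
have H4 k : (4 : R) ^+ k != 0 by rewrite expf_neq0.
have Hr k : rising s k != 0 by rewrite gt_eqF ?rising_gt0.
apply: (mulIf (H4 n.+1)); apply: (mulIf (Hr n.+1)).
rewrite [LHS](_ : _ = moment_coef s n.+1 * 4 ^+ n.+1 * rising s n.+1 *
  (n%:R + s *+ 2 - 1)); last by ring.
rewrite sq.
rewrite [RHS](_ : _ = 4 * (s + n%:R) * (n%:R + s - 2^-1) *
  (moment_coef s n * 4 ^+ n * rising s n)); last by rewrite exprS risingS; ring.
rewrite sq.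
set x := s *+ 2 + n%:R *+ 2 - 2.
have -> : s *+ 2 + n.+1%:R *+ 2 - 2 = x + 1 + 1 by rewrite /x -natr1; ring.
have key : n.+1%:R * gbin (x + 1 + 1) n.+1 * (x + 1 - n%:R) =
           (x + 1 + 1) * (x + 1) * gbin x n.
  by rewrite gbin_head -mulrA [_ * (_ - _)]mulrC -gbinS gbin_head mulrA.
rewrite factS natrM.
transitivity (n`!%:R * (n.+1%:R * gbin (x + 1 + 1) n.+1 * (x + 1 - n%:R))).
  by rewrite /x; ring.
by rewrite key /x; field.
Qed.

(** If s - 1/2 >= 1/4, four factors of the ratio compensate the growth of one
    linear factor: [moment_coef s n ^+ 4 * (n + 1/2)] does not increase. *)
Lemma moment_coef_cvg0_large s : 3 / 4 < s -> moment_coef s n @[n --> \oo] --> 0.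
Proof.
move=> s34; have s0 : 0 < s by lra.
have bnd n : moment_coef s n ^+ 4 * (n%:R + 2^-1) <= 2^-1.
  elim: n => [|n IH]; first by rewrite moment_coef0 expr1n add0r mul1r.
  apply: le_trans IH; have := moment_coefS n s0; have := moment_coef_ge0 n s0.
  have := moment_coef_ge0 n.+1 s0; rewrite -[n.+1%:R]natr1.
  move: (moment_coef s n) (moment_coef s n.+1) => m m' m'0 m0 mm'.
  have n0 : 0 <= n%:R :> R by rewrite ler0n.
  move: (n%:R : R) n0 mm' => x x0 mm'.
  have d0 : 0 < (x + s *+ 2 - 1) ^+ 4 by rewrite exprn_gt0//; lra.
  rewrite -(ler_pM2r d0) mulrAC -exprMn mm' exprMn -[leLHS]mulrA -[leRHS]mulrA.
  apply: ler_wpM2l; first exact: exprn_ge0.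
  pose e := s - 2^-1; pose u := x + e.
  have e0 : 4^-1 < e by rewrite /e; lra.
  have u0 : 0 <= u by rewrite /u; lra.
  (* With u = x + e the claim is u^4 (x + 3/2) <= (u + e)^4 (x + 1/2); in the
     difference, 4 e >= 1 makes the last bracket nonnegative. *)
  rewrite -subr_ge0 [X in 0 <= X](_ : _ =
     (x + 2^-1) * (6 * u ^+ 2 * e ^+ 2 + 4 * u * e ^+ 3 + e ^+ 4) +
     u ^+ 3 * (x * (4 * e - 1) + e)); last by rewrite /u /e; field.
  have ex k : 0 <= e ^+ k by rewrite exprn_ge0//; lra.
  have ux k : 0 <= u ^+ k by rewrite exprn_ge0.
  apply: addr_ge0; apply: mulr_ge0; [lra| |exact: ux|].
    have h1 : 0 <= 6 * u ^+ 2 * e ^+ 2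
      by exact: mulr_ge0 (mulr_ge0 _ (ux 2%N)) (ex 2%N).
    have h2 : 0 <= 4 * u * e ^+ 3 by exact: mulr_ge0 (mulr_ge0 _ u0) (ex 3%N).
    exact: addr_ge0 (addr_ge0 h1 h2) (ex 4%N).
  by apply: addr_ge0; [apply: mulr_ge0 => //; lra|lra].
apply/cvgrPdist_le => /= eps eps0.
near=> n; rewrite sub0r normrN ger0_norm ?moment_coef_ge0//.
rewrite -(@ler_pXn2r _ 4)// ?nnegrE ?moment_coef_ge0 ?(ltW eps0)//.
have n0 : 0 < n%:R + 2^-1 :> R by rewrite ltr_wpDl.
rewrite -(ler_pM2r n0) (le_trans (bnd n))//.
have e4 : 0 < eps ^+ 4 by rewrite exprn_gt0.
rewrite -ler_pdivrMl// (@le_trans _ _ n%:R) ?lerDl//.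
by near: n; exact: nbhs_infty_ger.
Unshelve. all: by end_near. Qed.

(** The ratios of [moment_coef] tend to 1, so division by p ^ n leaves a
    sequence that is eventually dominated by a geometric one. *)
Lemma moment_coef_cvg0_geom s p : 0 < s -> 1 < p ->
  moment_coef s n / p ^+ n @[n --> \oo] --> 0.
Proof.
move=> s0 p1; pose b n := moment_coef s n / p ^+ n.
have p0 : 0 < p by lra.
have b0 n : 0 <= b n by rewrite divr_ge0 ?moment_coef_ge0// exprn_ge0// ltW.
(* From N on, the ratios of [moment_coef] are below q, those of b below q / p. *)
pose q := (1 + p) / 2; have q1 : 1 < q by rewrite /q; lra.
pose r := q / p; have r0 : 0 < r by rewrite divr_gt0//; lra.
have r1 : r < 1 by rewrite ltr_pdivrMr// mul1r /q; lra.
pose N := Num.truncn (`|s - 2^-1 - q * (s *+ 2 - 1)| / (q - 1) + 1).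
have stepb n : (N < n)%N -> b n.+1 <= r * b n.
  move=> Nn; have Nn' : `|s - 2^-1 - q * (s *+ 2 - 1)| / (q - 1) + 1 < n%:R.
    by rewrite (lt_le_trans (truncnS_gt _))// ler_nat.
  have n1 : 1 <= n%:R :> R.
    by rewrite ltW// (le_lt_trans _ Nn')// lerDr divr_ge0//; lra.
  rewrite /b /r exprS invfM mulrA [leRHS](_ :
    _ = (q * moment_coef s n) / p / p ^+ n); last by ring.
  rewrite ler_pM2r ?invr_gt0 ?exprn_gt0// ler_pM2r ?invr_gt0//.
  have d0 : 0 < n%:R + s *+ 2 - 1 by lra.
  rewrite -(ler_pM2r d0) moment_coefS// [leRHS](_ :
    _ = moment_coef s n * (q * (n%:R + s *+ 2 - 1))); last by ring.
  apply: ler_wpM2l; first exact: moment_coef_ge0.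
  have : `|s - 2^-1 - q * (s *+ 2 - 1)| <= (q - 1) * n%:R.
    by rewrite -ler_pdivrMl ?subr_gt0// mulrC; lra.
  by move=> /(le_trans (ler_norm _)); lra.
have geo k : b (k + N.+1)%N <= b N.+1 * r ^+ k.
  elim: k => [|k IH]; first by rewrite add0n expr0 mulr1.
  rewrite addSn (le_trans (stepb _ _)) ?leq_addl// exprS.
  by rewrite [leRHS]mulrCA; apply: ler_wpM2l => //; exact: ltW.
rewrite -/b -(cvg_shiftn N.+1); apply: (@squeeze_cvgr _ _ _ _ (cst 0) (fun k =>
  b N.+1 * r ^+ k)).
- by near=> k; rewrite b0 geo.
- exact: cvg_cst.
- rewrite -[X in _ --> X](mulr0 (b N.+1)); apply: cvgM; first exact: cvg_cst.
  by apply: cvg_expr; rewrite ger0_norm// ltW.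
Unshelve. all: by end_near. Qed.

Lemma exp_coeff_partial_le (x : R) n : 0 <= x ->
  \sum_(k < n) x ^+ k / k`!%:R <= expR x.
Proof.
move=> x0; rewrite -[leLHS](big_mkord xpredT (fun k => x ^+ k / k`!%:R)).
apply: (@nondecreasing_cvgn_le _ (series (exp_coeff x))).
  by apply: nondecreasing_series => i _ _; rewrite /exp_coeff divr_ge0 ?exprn_ge0.
exact: is_cvg_series_exp_coeff.
Qed.

(** The terms with a small b n are absorbed in eps / 2 * exp x.  The first N
    terms are of lower order, since x ^ k / k! is (k + 1) / x times a term of
    the same exponential series. *)
Lemma exp_series_little_o (b : nat -> R) : (forall n, 0 <= b n) ->
  b n @[n --> \oo] --> 0 -> forall eps, 0 < eps ->
  \forall x \near +oo, (\sum_(0 <= n <oo) (b n * x ^+ n / n`!%:R)%:E <=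
    (eps * expR x)%:E)%E.
Proof.
move=> b0 bcvg eps eps0.
have [B B0 bB] : exists2 B, 0 < B & forall n, b n <= B.
  have /cvg_seq_bounded : cvgn b by apply/cvg_ex; exists 0.
  move=> [M [_ HM]]; exists (Num.max M 0 + 1).
    by rewrite ltr_wpDl// le_max lexx orbT.
  move=> n; rewrite (le_trans (ler_norm _))// HM//.
  by rewrite ltr_pwDr// le_max lexx.
have [N _ bN] : \forall n \near \oo, b n <= eps / 2.
  have /cvgrPdist_le/(_ (eps / 2)) := bcvg; rewrite divr_gt0// => /(_ isT).
  by apply: filterS => n; rewrite sub0r normrN ger0_norm.
near=> x.
have x1 : 1 <= x by near: x; exact: nbhs_pinfty_ge.
have x0 : 0 < x by lra.
have e_ge0 k : 0 <= x ^+ k / k`!%:R by rewrite divr_ge0// exprn_ge0// ltW.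
have term_ge0 k : 0 <= b k * x ^+ k / k`!%:R by rewrite -mulrA mulr_ge0.
apply: lime_le; first by apply: is_cvg_nneseries => n _ _; rewrite lee_fin.
apply: nearW => M.
rewrite sumEFin lee_fin big_mkord.
(* The first sum bounds the terms k < N, where (k + 1) / x <= N / x. *)
apply: (@le_trans _ _ (\sum_(k < M) (B * N%:R / x * (x ^+ k.+1 / k.+1`!%:R)) +
                       \sum_(k < M) (eps / 2 * (x ^+ k / k`!%:R)))).
  rewrite -big_split/=; apply: ler_sum => k _.
  have [kN|Nk] := ltnP k N.
    apply: ler_wpDr; first by rewrite mulr_ge0// divr_ge0// ltW.
    rewrite [leRHS](_ : _ = (B * (N%:R / k.+1%:R)) * (x ^+ k / k`!%:R)).
      rewrite -mulrA; apply: ler_wpM2r => //.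
      rewrite (le_trans (bB k))// ler_peMr ?(ltW B0)//.
      by rewrite ler_pdivlMr ?ltr0n// mul1r ler_nat.
    rewrite exprS factS natrM; field.
    by rewrite (gt_eqF x0) nat1r !pnatr_eq0/= andbT -lt0n fact_gt0.
  apply: ler_wpDl; last by rewrite -mulrA ler_wpM2r// bN.
  by rewrite mulr_ge0// ?divr_ge0 ?mulr_ge0 ?(ltW B0) ?(ltW x0)//.
rewrite -!mulr_sumr.
have h1 : \sum_(k < M) (x ^+ k.+1 / k.+1`!%:R) <= expR x.
  apply: le_trans (exp_coeff_partial_le M.+1 (ltW x0)).
  by rewrite big_ord_recl lerDr.
have h2 := exp_coeff_partial_le M (ltW x0).
have xB : B * N%:R / x <= eps / 2.
  rewrite ler_pdivrMr// -ler_pdivrMl ?divr_gt0//.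
rewrite (_ : eps * expR x = eps / 2 * expR x + eps / 2 * expR x); last by field.
apply: lerD; last by rewrite ler_wpM2l// divr_ge0// ltW.
apply: ler_pM => //; first by rewrite divr_ge0 ?mulr_ge0 ?(ltW B0) ?(ltW x0).
by apply: sumr_ge0 => k _; exact: e_ge0.
Unshelve. all: by end_near. Qed.
End coefficients.

(** * The Riemann-Lebesgue lemma on [-1, 1] *)

Section rintegral_extra.
Context d (T : measurableType d) {R : realType}.
Variables (mu : {measure set T -> \bar R}) (D : set T) (mD : measurable D).

Lemma bounded_measurable_integrable (f : T -> R) (M : R) : (mu D < +oo)%E ->
  measurable_fun D f -> (forall x, D x -> `|f x| <= M) ->
  mu.-integrable D (EFin \o f).
Proof.
move=> muD mf fM; apply: measurable_bounded_integrable => //.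
exists M; split; first exact: num_real.
by move=> x Mx y Dy; exact: le_trans (fM y Dy) (ltW Mx).
Qed.

Lemma integrable_sum_EFin (I : Type) (s : seq I) (f : I -> T -> R) :
  (forall i, mu.-integrable D (EFin \o f i)) ->
  mu.-integrable D (EFin \o (fun x => \sum_(i <- s) f i x)).
Proof.
move=> intf.
have := integrable_sum mD s (P := xpredT) (h := fun i => EFin \o f i)
  (fun i _ => intf i).
by apply: eq_integrable => // x _ /=; rewrite sumEFin.
Qed.

Lemma Rintegral_sum (I : Type) (s : seq I) (f : I -> T -> R) :
  (forall i, mu.-integrable D (EFin \o f i)) ->
  \int[mu]_(x in D) (\sum_(i <- s) f i x) = \sum_(i <- s) \int[mu]_(x in D) f i x.
Proof.
move=> intf; elim: s => [|a s IH].
  rewrite big_nil; under eq_Rintegral do rewrite big_nil.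
  by rewrite Rintegral_cst// mul0r.
rewrite big_cons -IH -RintegralD//; last exact: integrable_sum_EFin.
by under eq_Rintegral do rewrite big_cons.
Qed.

End rintegral_extra.

Section riemann_lebesgue.
Context {R : realType}.
Notation mu := (@lebesgue_measure R).
Notation D := (`[(-1 : R), 1]%classic : set R).

Lemma measurable_itvN11 : measurable (D : set (measurableTypeR R)).
Proof. exact: measurable_itv. Qed.

Lemma lebesgue_itvN11 : mu D = 2%:E.
Proof.
by rewrite lebesgue_measure_itv/= lte_fin ifT ?EFinB; [congr (_%:E); lra|lra].
Qed.

Lemma lebesgue_itvN11_fin : (mu D < +oo)%E.
Proof. by rewrite lebesgue_itvN11 ltry. Qed.

Lemma measurable_cosM (a : R) : measurable_fun D (fun s => cos (a * s)).
Proof.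
apply: measurable_funTS; apply: measurableT_comp => //.
  by apply: continuous_measurable_fun; exact: continuous_cos.
Qed.

Lemma int_cos_bound (a : R) : `|\int[mu]_(s in D) cos (a * s)| <= 2.
Proof.
have int_cos : mu.-integrable D (EFin \o (fun s : R => cos (a * s))).
  apply: (@bounded_measurable_integrable _ _ _ mu _ measurable_itvN11 _ 1) => //.
  - exact: lebesgue_itvN11_fin.
  - exact: measurable_cosM.
  - by move=> s _; exact: cos_max.
apply: (le_trans (le_normr_Rintegral _ int_cos)) => //.
have -> : 2 = \int[mu]_(s in D) (1 : R)
  by rewrite Rintegral_cst// mul1r -[LHS]/(fine 2%:E) -lebesgue_itvN11.
apply: le_Rintegral => //.
- exact: (@integrable_norm _ _ _ mu D (fun s => cos (a * s))).
- by apply: (@bounded_measurable_integrable _ _ _ mu _ measurable_itvN11 _ 1) => //;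
    [exact: lebesgue_itvN11_fin|move=> s _; rewrite normr1].
- by move=> s _; exact: cos_max.
Qed.

Lemma int_cosE (a : R) : a != 0 -> \int[mu]_(s in D) cos (a * s) = 2 * sin a / a.
Proof.
move=> a0; pose F s := sin (a * s) / a.
have dF (x : R) : is_derive x 1 F (cos (a * x)).
  have -> : F = a^-1 \*: (@sin R \o (a \*: id)).
    by apply/funext => s; rewrite /F /= mulrC.
  apply: is_derive_eq.
  by rewrite /GRing.scale/= mulr1 mulrCA mulVf// mulr1.
rewrite /Rintegral (@continuous_FTC2 _ _ F).
- rewrite /= /F mulr1 mulrN1 sinN; field; exact: a0.
- lra.
- apply: continuous_subspaceT => x; apply: continuous_comp; last exact: continuous_cos.
  exact: mulrl_continuous.
- have cF : continuous F.
    move=> x; apply: differentiable_continuous; apply/derivable1_diffP;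
      exact: ex_derive.
  split.
  + by move=> x _; exact: ex_derive.
  + by apply: cvg_at_right_filter; exact: cF.
  + by apply: cvg_at_left_filter; exact: cF.
- by move=> x _; rewrite derive1E; exact: derive_val.
Qed.

Lemma int_cos_decay (a : R) : 0 < `|a| -> `|\int[mu]_(s in D) cos (a * s)| <= 2 / `|a|.
Proof.
rewrite normr_gt0 => a0; rewrite int_cosE// normrM normfV ler_pM2r ?invr_gt0
  ?normr_gt0//.
by rewrite normrM ger0_norm// ler_piMr// sin_max.
Qed.

Lemma int_coscos (a b : R) : \int[mu]_(s in D) (cos (a * s) * cos (b * s)) =
  2^-1 * (\int[mu]_(s in D) cos ((a - b) * s) + \int[mu]_(s in D) cos ((a + b) * s)).
Proof.
have ic c : mu.-integrable D (EFin \o (fun s : R => cos (c * s))).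
  apply: (@bounded_measurable_integrable _ _ _ mu _ measurable_itvN11 _ 1).
  - exact: lebesgue_itvN11_fin.
  - exact: measurable_cosM.
  - by move=> s _; exact: cos_max.
rewrite -RintegralD ?ic// -RintegralZl//; last first.
  exact: (integrableD measurable_itvN11 (ic _) (ic _)).
apply: eq_Rintegral => s _.
by rewrite mulrBl mulrDl cosB cosD; field.
Qed.

(** A Bessel-type argument.  Cosines of N frequencies with gaps at least N are
    almost orthogonal on [-1, 1], so omega cannot correlate with all of them by
    more than eps unless N * eps ^ 2 is bounded by a multiple of M ^ 2. *)
Lemma riemann_lebesgue (omega : R -> R) (M : R) :
  measurable_fun D omega -> (forall s, D s -> `|omega s| <= M) ->
  forall eps, 0 < eps -> exists2 A, 0 < A & forall l : R, A <= `|l| ->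
    `|\int[mu]_(s in D) (omega s * cos (l * s))| <= eps.
Proof.
move=> momega oM eps eps0; apply: contrapT => hyp.
have M0 : 0 <= M.
  by rewrite (le_trans _ (oM 0 _))//= in_itv/= lerN10 ler01.
pose psi (l : R) : R := \int[mu]_(s in D) (omega s * cos (l * s)).
have psiN l : psi (- l) = psi l.
  by apply: eq_Rintegral => s _; rewrite mulNr cosN.
have pick A : exists l, A <= l /\ eps < `|psi l|.
  apply: contrapT => hA; apply: hyp.
  exists (Num.max A 1); first by rewrite lt_max ltr01 orbT.
  move=> l; rewrite ge_max => /andP[Al _].
  rewrite leNgt; apply/negP => psil; apply: hA; exists `|l|; split=> //.
  by case: (ger0P l) => _ //; rewrite psiN.
(* The argument below yields N * eps ^ 2 / 4 <= 2 * M ^ 2; this N violates it. *)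
pose N := (Num.truncn (8 * M ^+ 2 / eps ^+ 2)).+1.
have N0 : 0 < N%:R :> R by rewrite ltr0n.
have NM : 8 * M ^+ 2 < N%:R * eps ^+ 2.
  by rewrite -ltr_pdivrMr ?exprn_gt0// truncnS_gt.
have [f fP] := choice pick.
(* Frequencies where the integral exceeds eps, with gaps at least N. *)
pose fix lam k := if k is k'.+1 then f (lam k' + N%:R) else f N%:R.
have psil k : eps < `|psi (lam k)| by case: k => [|k]; exact: (fP _).2.
have lam0 k : N%:R <= lam k.
  elim: k => [|k IH] /=; first by have [] := fP N%:R.
  by have [h _] := fP (lam k + N%:R); apply: (le_trans _ h); lra.
have lamlt j k : (j < k)%N -> lam j + N%:R <= lam k.
  elim: k => // k IH; rewrite ltnS leq_eqVlt => /predU1P[->|jk] /=.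
    by have [] := fP (lam k + N%:R).
  have [h _] := fP (lam k + N%:R); apply: (le_trans _ h).
  by rewrite (le_trans (IH jk))// lerDl ltW.
have lamdiff (j k : nat) : j != k -> N%:R <= `|lam j - lam k|.
  by rewrite neq_ltn => /orP[] /lamlt; [rewrite distrC|] => h;
    rewrite (le_trans _ (ler_norm _))// lerBrDl.
pose e k := Num.sg (psi (lam k)).
have e1 k : `|e k| <= 1 by rewrite normr_sg; case: (_ != 0).
pose c (s : R) (k : nat) : R := cos (lam k * s).
pose g (s : R) : R := \sum_(k < N) e k * c s k.
have ibd (h : R -> R) (B : R) : measurable_fun D h -> (forall s, D s -> `|h s| <= B) ->
    mu.-integrable D (EFin \o h).
  by move=> mh hB; exact: (@bounded_measurable_integrable _ _ _ mu _ measurable_itvN11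
    _ B lebesgue_itvN11_fin).
have mc k : measurable_fun D (fun s => c s k) by exact: measurable_cosM.
have c1 s k : `|c s k| <= 1 by exact: cos_max.
have icc (j k : nat) : mu.-integrable D (EFin \o (fun s => c s j * c s k)).
  apply: (ibd _ 1); first exact: measurable_funM.
  by move=> s _; rewrite normrM mulr_ile1.
have ioc k : mu.-integrable D (EFin \o (fun s => omega s * c s k)).
  apply: (ibd _ M); first exact: measurable_funM.
  by move=> s Ds; rewrite normrM -[M]mulr1 ler_pM// oM.
have ioo : mu.-integrable D (EFin \o (fun s => omega s ^+ 2)).
  apply: (ibd _ (M ^+ 2)); first exact: measurable_funX.
  by move=> s Ds; rewrite normrX lerXn2r ?nnegrE// oM.
have igg : mu.-integrable D (EFin \o (fun s => g s ^+ 2)).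
  apply: (ibd _ (N%:R ^+ 2)).
    apply: measurable_funX; apply: measurable_sum => k.
    by apply: measurable_funM.
  move=> s _; rewrite normrX lerXn2r ?nnegrE//.
  rewrite (le_trans (ler_norm_sum _ _ _))//.
  rewrite (@le_trans _ _ (\sum_(k < N) 1))//; last by rewrite sumr_const card_ord.
  by apply: ler_sum => k _; rewrite normrM mulr_ile1.
have iog : mu.-integrable D (EFin \o (fun s => omega s * g s)).
  have := integrable_sum_EFin measurable_itvN11 (enum 'I_N)
    (fun k : 'I_N => integrableZl measurable_itvN11 (e k) (ioc k)).
  apply: eq_integrable => // s _ /=.
  rewrite big_enum /g mulr_sumr; congr (_%:E).
  by apply: eq_bigr => k _; rewrite mulrCA.
have oo_le : \int[mu]_(s in D) (omega s ^+ 2) <= 2 * M ^+ 2.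
  rewrite (@le_trans _ _ (\int[mu]_(s in D) (M ^+ 2)))//.
    apply: le_Rintegral => //; first by apply: (ibd _ (M ^+ 2)) => // s _;
      rewrite ger0_norm ?sqr_ge0.
    by move=> s Ds; rewrite -real_normK ?num_real// lerXn2r ?nnegrE// oM.
  by rewrite Rintegral_cst// mulrC -[X in _ <= X * _]/(fine 2%:E) -lebesgue_itvN11.
have og_ge : N%:R * eps <= \int[mu]_(s in D) (omega s * g s).
  rewrite (_ : \int[mu]_(s in D) _ = \sum_(k < N) `|psi (lam k)|).
    rewrite mulr_natl -[N in _ *+ N]card_ord -sumr_const.
    by apply: ler_sum => k _; exact/ltW/psil.
  transitivity (\int[mu]_(s in D) \sum_(k < N) e k * (omega s * c s k)).
    apply: eq_Rintegral => s _; rewrite /g mulr_sumr.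
    by apply: eq_bigr => k _; rewrite mulrCA.
  rewrite Rintegral_sum//; last by move=> k;
    exact: (integrableZl measurable_itvN11 (e k) (ioc k)).
  by apply: eq_bigr => k _; rewrite RintegralZl// normrEsg.
have gg_le : \int[mu]_(s in D) (g s ^+ 2) <= 4 * N%:R.
  rewrite (_ : \int[mu]_(s in D) _ =
    \sum_(j < N) \sum_(k < N) e j * e k * \int[mu]_(s in D) (c s j * c s k));
      last first.
    transitivity (\int[mu]_(s in D) \sum_(j < N) \sum_(k < N) e j * e k *
      (c s j * c s k)).
      apply: eq_Rintegral => s _; rewrite /g expr2 mulr_suml.
      apply: eq_bigr => j _; rewrite mulr_sumr; apply: eq_bigr => k _; ring.
    have iee (j k : 'I_N) :
        mu.-integrable D (EFin \o (fun s => e j * e k * (c s j * c s k))).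
      exact: (integrableZl measurable_itvN11 (e j * e k) (icc j k)).
    rewrite Rintegral_sum//; last by move=> j; exact: integrable_sum_EFin.
    apply: eq_bigr => j _; rewrite Rintegral_sum//.
    by apply: eq_bigr => k _; rewrite RintegralZl.
  (* By the gaps, the Gram matrix is at most 2 on the diagonal, 2 / N elsewhere. *)
  have cc_le (j k : 'I_N) : e j * e k * \int[mu]_(s in D) (c s j * c s k) <=
      (j == k)%:R * 2 + 2 / N%:R.
    apply: (le_trans (ler_norm _)); rewrite normrM.
    rewrite (le_trans (ler_piMl _ _))// ?normrM ?mulr_ile1//.
    rewrite /c int_coscos normrM ger0_norm//.
    have [->|jk] := eqVneq j k.
      rewrite mul1r ler_wpDr ?divr_ge0//.
      have := ler_normD (\int[mu]_(s in D) cos ((lam k - lam k) * s))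
        (\int[mu]_(s in D) cos ((lam k + lam k) * s)).
      by have := int_cos_bound (lam k - lam k);
        have := int_cos_bound (lam k + lam k); lra.
    rewrite mul0r add0r.
    have dec a : N%:R <= `|a| -> `|\int[mu]_(s in D) cos (a * s)| <= 2 / N%:R.
      move=> aN; have a0 : 0 < `|a| by exact: lt_le_trans aN.
      by rewrite (le_trans (int_cos_decay a0))// ler_pM2l// lef_pV2 ?posrE.
    have := ler_normD (\int[mu]_(s in D) cos ((lam j - lam k) * s))
      (\int[mu]_(s in D) cos ((lam j + lam k) * s)).
    have := dec _ (lamdiff j k jk).
    have : `|\int[mu]_(s in D) cos ((lam j + lam k) * s)| <= 2 / N%:R.
      by apply: dec; rewrite (le_trans _ (ler_norm _))//; have := lam0 j;
        have := lam0 k; lra.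
    lra.
  apply: (@le_trans _ _ (\sum_(j < N) \sum_(k < N) ((j == k)%:R * 2 + 2 / N%:R))).
    by apply: ler_sum => j _; apply: ler_sum => k _; exact: cc_le.
  rewrite (eq_bigr (fun=> 4)); first by rewrite sumr_const card_ord mulr_natr.
  move=> j _; rewrite big_split/= sumr_const card_ord -mulr_suml.
  rewrite (bigD1 j)//= eqxx big1 ?addr0 => [|k /negbTE]; last by rewrite eq_sym => ->.
  rewrite -(mulr_natr (2 / N%:R)) mulfVK ?gt_eqF// mulr1n; lra.
(* The coefficient c = eps / 4 minimises the bound 2 M^2 - 2 c N eps + 4 c^2 N. *)
have : 0 <= \int[mu]_(s in D) ((omega s - eps / 4 * g s) ^+ 2).
  by apply: Rintegral_ge0 => s _; exact: sqr_ge0.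
rewrite (_ : \int[mu]_(s in D) _ = \int[mu]_(s in D) (omega s ^+ 2) -
   eps / 2 * \int[mu]_(s in D) (omega s * g s) +
   (eps / 4) ^+ 2 * \int[mu]_(s in D) (g s ^+ 2)); last first.
  rewrite -!RintegralZl// -RintegralB//;
    last exact: (integrableZl measurable_itvN11 _ iog).
  rewrite -RintegralD//; last 2 first.
  - exact: (integrableB measurable_itvN11 ioo (integrableZl measurable_itvN11
    (eps / 2) iog)).
  - exact: (integrableZl measurable_itvN11 _ igg).
  by apply: eq_Rintegral => s _; field.
apply/negP; rewrite -ltNge.
have h1 : eps / 2 * (N%:R * eps) <= eps / 2 * \int[mu]_(s in D) (omega s * g s).
  by rewrite ler_wpM2l// divr_ge0// ltW.
have h2 : (eps / 4) ^+ 2 * \int[mu]_(s in D) (g s ^+ 2) <= (eps / 4) ^+ 2 * (4 * N%:R).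
  by rewrite ler_wpM2l// sqr_ge0.
rewrite [X in _ <= X](_ : _ = N%:R * eps ^+ 2 / 4) in h2; last by field.
rewrite [X in X <= _](_ : _ = N%:R * eps ^+ 2 / 2) in h1; last by field.
move: h1 h2 oo_le NM.
move: (\int[mu]_(s in D) (omega s ^+ 2)) (\int[mu]_(s in D) (omega s * g s))
  (\int[mu]_(s in D) (g s ^+ 2)) => I1 I2 I3.
move: (N%:R * eps ^+ 2) (eps / 2 * I2) (_ * I3) (M ^+ 2) => X Y Z W h1 h2 h3 h4;
  clear -h1 h2 h3 h4; lra.
Qed.
End riemann_lebesgue.

(** * Densities and the Gamma integral *)

Section density.
Local Open Scope ereal_scope.
Context d (T : measurableType d) {R : realType}.
Variables (nu : {finite_measure set T -> \bar R})
  (mu : {sigma_finite_measure set T -> \bar R}) (p : T -> \bar R).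
Hypothesis mp : measurable_fun setT p.
Hypothesis nup : forall A, measurable A -> nu A = \int[mu]_(x in A) p x.

Lemma density_dominates : nu `<< mu.
Proof.
apply/null_content_dominatesP => A mA muA0; rewrite nup//.
by apply: null_set_integral => //; exact: measurable_funTS.
Qed.

(** A density agrees almost everywhere with the Radon-Nikodym derivative, for
    which the formula is known. *)
Lemma ge0_integral_density (g : T -> \bar R) : measurable_fun setT g ->
  (forall x, 0 <= g x) -> \int[nu]_x g x = \int[mu]_x (g x * p x).
Proof.
move=> mg g0; have numu := density_dominates.
rewrite -(Radon_Nikodym_SigmaFinite.change_of_variables numu)//.
have mf := measurable_int mu (Radon_Nikodym_SigmaFinite.f_integrable numu).
apply: ae_eq_integral => //; [exact: emeasurable_funM..|].
apply: ae_eqe_mul2l; apply: integral_ae_eq => //.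
- exact: Radon_Nikodym_SigmaFinite.f_integrable.
- by move=> A _ mA; rewrite -Radon_Nikodym_SigmaFinite.f_integral// nup.
Qed.
End density.

Section gamma_recursion.
Context {R : realType}.
Notation mu := (@lebesgue_measure R).
Implicit Types (c s x : R).

Definition gamma_kernel c s x : R := x `^ (s - 1) * expR (- (c * x)).

Definition gamma_int c s : \bar R :=
  (\int[mu]_(x in `]0%R, +oo[) (gamma_kernel c s x)%:E)%E.

Lemma measurable_gamma_kernel c s : measurable_fun setT (gamma_kernel c s).
Proof.
apply: measurable_funM; first exact: measurable_powR.
apply: measurableT_comp => //; apply: measurableT_comp => //.
Qed.

Lemma gamma_kernel_ge0 c s x : 0 <= gamma_kernel c s x.
Proof. by rewrite mulr_ge0 ?powR_ge0 ?expR_ge0. Qed.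

Lemma is_derive_gamma_kernel c s x : 0 < x ->
  is_derive x 1 (gamma_kernel c (s + 1))
    (s * gamma_kernel c s x - c * gamma_kernel c (s + 1) x).
Proof.
move=> x0; have -> : gamma_kernel c (s + 1) =
  (@powR R ^~ s) * (@expR R \o ((- c) \*: id)).
  by apply/funext => y; rewrite /gamma_kernel addrK -mulNr.
have dp := @is_derive1_powR R s x x0.
apply: is_derive_eq.
change (x `^ s * (expR (- c * x) * (- c * 1)) + expR (- c * x) * (s * x `^ (s - 1)) =
  s * (x `^ (s - 1) * expR (- (c * x))) - c * (x `^ s * expR (- c * x))).
rewrite mulNr; ring.
Qed.

Lemma gamma_kernel_continuous c s x : 0 < x -> {for x, continuous (gamma_kernel c s)}.
Proof.
move=> x0; apply: differentiable_continuous; apply/derivable1_diffP.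
rewrite (_ : s = s - 1 + 1); last by ring.
by have dk := is_derive_gamma_kernel c (s - 1) x0; exact: ex_derive.
Qed.

Lemma gamma_kernel_parts c s a b : 0 < a -> a < b ->
  (s%:E * \int[mu]_(x in `[a, b]) (gamma_kernel c s x)%:E =
   c%:E * \int[mu]_(x in `[a, b]) (gamma_kernel c (s + 1) x)%:E +
   (gamma_kernel c (s + 1) b - gamma_kernel c (s + 1) a)%:E)%E.
Proof.
move=> a0 ab.
have mab : measurable (`[a, b]%classic : set (measurableTypeR R))
  by exact: measurable_itv.
have cw s' : {within `[a, b], continuous (gamma_kernel c s')}.
  apply: continuous_in_subspaceT => x; rewrite inE/= in_itv/= => /andP[ax _].
  by apply: gamma_kernel_continuous; exact: lt_le_trans ax.
have ik s' : mu.-integrable `[a, b] (EFin \o gamma_kernel c s').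
  by apply: continuous_compact_integrable => //; exact: segment_compact.
have ftc : (\int[mu]_(x in `[a, b])
      (s * gamma_kernel c s x - c * gamma_kernel c (s + 1) x)%:E =
    (gamma_kernel c (s + 1) b)%:E - (gamma_kernel c (s + 1) a)%:E)%E.
  apply: continuous_FTC2 => //.
  - apply: continuous_in_subspaceT => x; rewrite inE/= in_itv/= => /andP[ax _].
    have x0 : 0 < x by exact: lt_le_trans ax.
    by apply: cvgB; apply: cvgM; (try exact: cvg_cst); exact: gamma_kernel_continuous.
  - split.
    + move=> x; rewrite in_itv/= => /andP[ax _].
      by have dk := is_derive_gamma_kernel c s (lt_trans a0 ax); exact: ex_derive.
    + by apply: cvg_at_right_filter; exact: gamma_kernel_continuous.
    + by apply: cvg_at_left_filter; apply: gamma_kernel_continuous; exact: lt_trans ab.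
  - move=> x; rewrite in_itv/= => /andP[ax _].
    have dk := is_derive_gamma_kernel c s (lt_trans a0 ax).
    by rewrite derive1E; exact: derive_val.
rewrite EFinB -ftc -!integralZl//; [|exact: ik|exact: ik].
under [X in (_ + X)%E]eq_integral do rewrite EFinB.
rewrite integralB//; [|exact: (integrableZl mab s (ik s))|exact: (integrableZl mab c
  (ik (s + 1)))].
rewrite addeCA subee ?adde0//.
by apply: integrable_fin_num => //; exact: (integrableZl mab c (ik (s + 1))).
Qed.

Lemma gamma_kernel_cvg0 c s : 0 < c -> 0 < s ->
  gamma_kernel c (s + 1) n.+1%:R - gamma_kernel c (s + 1) n.+1%:R^-1 @[n --> \oo] --> 0.
Proof.
move=> c0 s0; rewrite /gamma_kernel addrK -[X in _ --> X]subr0; apply: cvgB.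
(* For y >= 1, y ^ s <= y ^ k, and exp (c y) exceeds the term of degree k + 1
   of its series. *)
- pose k := (Num.truncn s).+1.
  pose C := k.+1`!%:R / c ^+ k.+1.
  have C0 : 0 < C by rewrite divr_gt0 ?exprn_gt0// ltr0n fact_gt0.
  apply: (@squeeze_cvgr _ _ _ _ (cst 0) (fun n => C * n.+1%:R^-1)); last 2 first.
  + exact: cvg_cst.
  + rewrite -[X in _ --> X](mulr0 C); apply: cvgM; first exact: cvg_cst.
    exact: cvg_harmonic.
  + apply: nearW => n; rewrite mulr_ge0 ?powR_ge0 ?expR_ge0//=.
    have n1 : 1 <= n.+1%:R :> R by rewrite ler1n.
    have n0 : 0 < n.+1%:R :> R by rewrite ltr0n.
    move: (n.+1%:R : R) n1 n0 => y y1 y0.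
    have ys : y `^ s <= y ^+ k.
      by rewrite -powR_mulrn ?(ltW y0)// ler_powR// ltW// truncnS_gt.
    have ey : (c * y) ^+ k.+1 / k.+1`!%:R <= expR (c * y).
      have cy0 : 0 <= c * y by rewrite mulr_ge0// ltW.
      apply: le_trans (exp_coeff_partial_le k.+2 cy0).
      rewrite big_ord_recr/= lerDr; apply: sumr_ge0 => i _.
      by rewrite divr_ge0// exprn_ge0.
    rewrite expRN ler_pdivrMr ?expR_gt0//.
    apply: (le_trans ys).
    rewrite [leLHS](_ : _ = C / y * ((c * y) ^+ k.+1 / k.+1`!%:R)).
      by apply: ler_wpM2l => //; rewrite divr_ge0 ?(ltW C0) ?(ltW y0).
    rewrite /C exprMn [y ^+ k.+1]exprS; field.
    by rewrite pnatr_eq0 -lt0n fact_gt0 (gt_eqF y0) expf_neq0 ?gt_eqF.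
- apply: (@squeeze_cvgr _ _ _ _ (cst 0) (fun n => (n.+1%:R^-1) `^ s)); last 2 first.
  + exact: cvg_cst.
  + have := powR_cvg0 s0.
    move=> /cvg_at_rightP; apply; split; last exact: cvg_harmonic.
    by move=> n; rewrite invr_gt0.
  + apply: nearW => n; rewrite mulr_ge0 ?powR_ge0 ?expR_ge0//=.
    rewrite ler_piMr ?powR_ge0// -expR0 ler_expR oppr_le0 mulr_ge0// ltW//.
Qed.

(** Integration by parts on [1/n, n], which avoids the singularity of
    [gamma_kernel c s] at 0 when s < 1.  In \bar R the identity
    holds before any of the integrals is known to be finite. *)
Lemma gamma_intS c s : 0 < c -> 0 < s ->
  (c%:E * gamma_int c (s + 1) = s%:E * gamma_int c s)%E.
Proof.
move=> c0 s0.
pose F n := (`[n.+1%:R^-1, n.+1%:R]%classic : set R).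
have FE : `]0%R, +oo[%classic = \bigcup_n F n.
  apply/seteqP; split=> x /=.
  - rewrite in_itv/= andbT => x0.
    exists (maxn (Num.truncn x) (Num.truncn x^-1)) => //=; rewrite /F/= in_itv/=.
    apply/andP; split.
      rewrite invf_ple ?posrE// ltW// (lt_le_trans (truncnS_gt _))//.
      by rewrite ler_nat ltnS leq_maxr.
    by rewrite ltW// (lt_le_trans (truncnS_gt _))// ler_nat ltnS leq_maxl.
  - move=> [n _]; rewrite /F/= !in_itv/= andbT => /andP[+ _].
    by apply: lt_le_trans; rewrite invr_gt0.
have ndF : nondecreasing_seq F.
  move=> m n mn; rewrite subsetEset; apply: subset_itv; rewrite bnd_simp.
    by rewrite lef_pV2 ?posrE// ler_nat ltnS.
  by rewrite ler_nat ltnS.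
have cv s' : (\int[mu]_(x in F n)
  (gamma_kernel c s' x)%:E @[n --> \oo] --> gamma_int c s')%E.
  rewrite /gamma_int FE; apply: ge0_nondecreasing_set_cvg_integral => //.
  - by move=> n; exact: measurable_itv.
  - by move=> n; apply/measurable_EFinP/measurable_funTS;
    exact: measurable_gamma_kernel.
  - by move=> n x _; rewrite lee_fin gamma_kernel_ge0.
have l1 : (s%:E * \int[mu]_(x in F n)
  (gamma_kernel c s x)%:E @[n --> \oo] --> s%:E * gamma_int c s)%E.
  by apply: cvgeZl => //; exact: cv.
have l2 : (c%:E * \int[mu]_(x in F n.+1) (gamma_kernel c (s + 1) x)%:E +
    (gamma_kernel c (s + 1) n.+2%:R - gamma_kernel c (s + 1) n.+2%:R^-1)%:E @[n --> \oo]
    --> c%:E * gamma_int c (s + 1) + 0)%E.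
  apply: cvgeD; first by rewrite fin_num_adde_defl.
  - have := cv (s + 1); rewrite -cvg_shiftS; exact: cvgeZl.
  - apply: cvg_EFin; first by apply: nearW.
    by have := gamma_kernel_cvg0 c0 s0; rewrite -cvg_shiftS.
rewrite -[LHS]adde0; apply: cvg_unique l2 _ => //.
move: l1; rewrite -cvg_shiftS; apply: cvg_trans; apply: near_eq_cvg; apply: nearW => n.
rewrite /F/= gamma_kernel_parts// invf_plt ?posrE//.
by rewrite (@lt_trans _ _ 1)// ?invf_lt1 ?ltr1n.
Qed.

Lemma gamma_int_rising c s n : 0 < c -> 0 < s ->
  ((c ^+ n)%:E * gamma_int c (s + n%:R) = (rising s n)%:E * gamma_int c s)%E.
Proof.
move=> c0 s0; elim: n => [|n IH]; first by rewrite addr0 rising0 expr0.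
rewrite exprSr EFinM -muleA -natr1 addrA gamma_intS//; last by rewrite ltr_wpDr.
by rewrite muleCA IH risingS EFinM muleCA muleA [((rising s n)%:E * _)%E]muleC.
Qed.

Lemma GammaE s : Gamma s = fine (gamma_int 1 s).
Proof.
rewrite /Gamma /Rintegral /gamma_int; congr fine.
by apply: eq_integral => x _; rewrite /gamma_kernel mul1r.
Qed.

Lemma Gamma_rising s n : 0 < s -> Gamma (s + n%:R) = rising s n * Gamma s.
Proof.
move=> s0; rewrite !GammaE.
have := gamma_int_rising n ltr01 s0; rewrite expr1n mul1e => ->.
have := rising_gt0 n s0; case: (gamma_int 1 s) => [r| |] r0 //=.
- by rewrite gt0_muley ?lte_fin// mulr0.
- by rewrite gt0_muleNy ?lte_fin// mulr0.
Qed.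
End gamma_recursion.

(** * Moments of the Gamma law *)

Section gamma_law.
Context {R : realType} d {T : measurableType d} (P : probability T R).
Variables (sigma theta : R) (z : {RV P >-> R}).
Hypotheses (sigma_gt0 : 0 < sigma) (theta_lt1 : theta < 1).
Hypothesis law : forall A : set R, measurable A ->
  distribution P z A = (\int[lebesgue_measure]_(x in A) (gamma_pdf sigma theta x)%:E)%E.
Notation mu := (@lebesgue_measure R).
Let A : R := (1 - theta) `^ sigma / Gamma sigma.
Let A_ge0 : 0 <= A.
Proof.
rewrite divr_ge0 ?powR_ge0// GammaE fine_ge0// integral_ge0// => x _.
by rewrite lee_fin gamma_kernel_ge0.
Qed.

Let pdfE x : gamma_pdf sigma theta x =
  A * (gamma_kernel (1 - theta) sigma x) * \1_(`]0, +oo[) x.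
Proof.
rewrite /gamma_pdf /A /gamma_kernel.
rewrite (_ : - ((1 - theta) * x) = theta * x + - x); last by ring.
rewrite expRD; ring.
Qed.

Let measurable_pdf : measurable_fun setT (fun x => (gamma_pdf sigma theta x)%:E).
Proof.
apply/measurable_EFinP; rewrite (funext pdfE).
apply: measurable_funM; last exact: measurable_indic.
by apply: measurable_funM => //; exact: measurable_gamma_kernel.
Qed.

(* Lebesgue measure lives on [measurableTypeR R], which has the measurable sets
   of R but another display; Z is z with values there. *)
Let mZ : measurable_fun setT (z : T -> measurableTypeR R) := measurable_funPT z.
Let Z : {RV P >-> measurableTypeR R} :=
  @mfun_Sub _ _ T (measurableTypeR R) z (mem_set mZ).

Let abs_moment n : (\int[P]_w (`|z w| ^+ n)%:E =
  A%:E * gamma_int (1 - theta) (sigma + n%:R))%E.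
Proof.
have mn : measurable_fun setT (fun x : R => (`|x| ^+ n)%:E).
  by apply/measurable_EFinP; apply: measurable_funX; exact: normr_measurable.
have n0 (x : R) : (0 <= (`|x| ^+ n)%:E)%E by rewrite lee_fin; exact: exprn_ge0.
rewrite -[LHS](@ge0_integral_distribution _ _ _ _ _ P Z (fun x => (`|x| ^+ n)%:E))//.
rewrite (@ge0_integral_density _ _ _ (distribution P Z)
  (@lebesgue_measure R) _ measurable_pdf law)//.
have mk : measurable_fun (`]0, +oo[%classic : set (measurableTypeR R))
    (EFin \o gamma_kernel (1 - theta) (sigma + n%:R)).
  by apply/measurable_EFinP/measurable_funTS; exact: measurable_gamma_kernel.
have k0 (x : R) : `]0, +oo[%classic x ->
  (0 <= (EFin \o gamma_kernel (1 - theta) (sigma + n%:R)) x)%E.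
  by rewrite /= lee_fin gamma_kernel_ge0.
rewrite /gamma_int -(ge0_integralZl mu _ mk k0)//.
rewrite [RHS]integral_mkcond; apply: eq_integral => x _.
rewrite pdfE patchE indicE; case: ifPn => [x0|_]; last by rewrite mulr0 mule0.
rewrite /= -!EFinM mulr1; congr (_%:E).
move: x0; rewrite inE/= in_itv/= andbT => x0.
rewrite /gamma_kernel ger0_norm ?(ltW x0)// -powR_mulrn ?(ltW x0)//.
rewrite (_ : sigma + n%:R - 1 = n%:R + (sigma - 1)); last by ring.
by rewrite (@powRD _ x n%:R (sigma - 1)) ?(gt_eqF x0) ?implybT//; ring.
Qed.

Let A1 : (A%:E * gamma_int (1 - theta) sigma = 1)%E.
Proof.
have := abs_moment 0; rewrite addr0 => <-.
by under eq_integral do rewrite expr0; rewrite integral_cst// mul1e;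
  exact: probability_setT.
Qed.

(** Otherwise the density would vanish and the law would have mass 0. *)
Lemma gamma_law_Gamma_neq0 : Gamma sigma != 0.
Proof.
apply/eqP => G0; have := A1; rewrite /A G0 invr0 mulr0 mul0e => /eqP.
by rewrite eqe eq_sym oner_eq0.
Qed.

(** [gamma_int_rising] reduces the n-th moment to the total mass of the law. *)
Lemma gamma_law_abs_moment n :
  (\int[P]_w (`|z w| ^+ n)%:E = (rising sigma n / (1 - theta) ^+ n)%:E)%E.
Proof.
have c0 : 0 < 1 - theta by rewrite subr_gt0.
have cn : (1 - theta) ^+ n != 0 by rewrite expf_neq0// gt_eqF.
rewrite abs_moment.
have -> : gamma_int (1 - theta) (sigma + n%:R) =
    ((rising sigma n / (1 - theta) ^+ n)%:E * gamma_int (1 - theta) sigma)%E.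
  rewrite mulrC EFinM -muleA -gamma_int_rising// muleA -EFinM.
  by rewrite mulVf// mul1e.
by rewrite muleCA A1 mule1.
Qed.

Lemma gamma_law_ae_ge0 : {ae P, forall w, 0 <= z w}.
Proof.
exists (z @^-1` `]-oo, 0]); split.
- exact: measurable_funPTI.
- transitivity (distribution P z `]-oo, 0]) => //.
  rewrite law//; apply: integral0_eq => x; rewrite /= in_itv/= => x0.
  by rewrite pdfE indicE memNset ?mulr0//= in_itv/= andbT; apply/negP; rewrite -leNgt.
- by move=> w /= /negP; rewrite -ltNge in_itv/= => /ltW.
Qed.

Lemma gamma_law_moment n :
  (\int[P]_w (z w ^+ n)%:E = (rising sigma n / (1 - theta) ^+ n)%:E)%E.
Proof.
rewrite -gamma_law_abs_moment; apply: ae_eq_integral => //.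
- by apply/measurable_EFinP; apply: measurable_funX.
- by apply/measurable_EFinP; apply: measurable_funX; apply: measurableT_comp.
- have := gamma_law_ae_ge0; apply: filterS => w z0 _.
  by rewrite ger0_norm.
Qed.

Lemma gamma_law_moment_integrable n : P.-integrable setT (EFin \o (fun w => z w ^+ n)).
Proof.
apply/integrableP; split; first by apply/measurable_EFinP; apply: measurable_funX.
under eq_integral do rewrite /= normrX.
by rewrite gamma_law_abs_moment ltry.
Qed.
End gamma_law.

(** * Termwise integration of dominated series *)

Section dominated_series.
Context {R : realType}.

Lemma dominated_series_cvg (f g : R^nat) :
  (forall n, `|f n| <= g n) -> cvgn (series g) -> cvgn (series f).
Proof.
move=> fg cg; apply: normed_cvg; apply: series_le_cvg cg => n /=; rewrite ?normr_ge0//.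
exact: le_trans (normr_ge0 _) (fg n).
Qed.

Lemma dominated_series_partial (f g : R^nat) :
  (forall n, `|f n| <= g n) -> cvgn (series g) ->
  forall N, `|series f N| <= limn (series g).
Proof.
move=> fg cg N.
apply: (@le_trans _ _ (series g N)).
  by rewrite (le_trans (ler_norm_sum _ _ _))// ler_sum.
apply: nondecreasing_cvgn_le => //; apply: nondecreasing_series => n _ _.
exact: le_trans (normr_ge0 _) (fg n).
Qed.

Lemma dominated_series_lim (f g : R^nat) :
  (forall n, `|f n| <= g n) -> cvgn (series g) ->
  `|limn (series f)| <= limn (series g).
Proof.
move=> fg cg; have cf := dominated_series_cvg fg cg.
rewrite -lim_norm//; apply: limr_le; first exact: is_cvg_norm.
by apply: nearW => N; exact: dominated_series_partial.
Qed.

Context d (T : measurableType d) (mu : {measure set T -> \bar R}).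
Variables (D : set T) (mD : measurable D) (f g : nat -> T -> R).
Hypothesis mf : forall n, measurable_fun D (f n).
Hypothesis fg : forall n x, D x -> `|f n x| <= g n x.
Hypothesis cg : forall x, D x -> cvgn (series (g ^~ x)).
Hypothesis ig : mu.-integrable D (EFin \o (fun x => limn (series (g ^~ x)))).

Lemma dominated_series_measurable :
  measurable_fun D (fun x => limn (series (f ^~ x))).
Proof.
apply: (@measurable_fun_cvg _ _ _ _ (fun N x => series (f ^~ x) N)).
  by move=> N; exact: measurable_sum.
move=> x Dx; apply: dominated_series_cvg (cg Dx) => n; exact: fg.
Qed.

Lemma Rintegral_dominated_series :
  series (fun n => \int[mu]_(x in D) f n x) @ \oo -->
  \int[mu]_(x in D) limn (series (f ^~ x)).
Proof.
have mS N : measurable_fun D (fun x => series (f ^~ x) N) by exact: measurable_sum.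
have iF (h : T -> R) : measurable_fun D h ->
    (forall x, D x -> `|h x| <= limn (series (g ^~ x))) ->
    mu.-integrable D (EFin \o h).
  move=> mh hG; apply: le_integrable ig => //; first exact/measurable_EFinP.
  by move=> x Dx /=; rewrite lee_fin (le_trans (hG _ Dx))// ler_norm.
have i_f n : mu.-integrable D (EFin \o f n).
  apply: iF => // x Dx; apply: le_trans (fg _ Dx) _.
  have g0 k : 0 <= g k x by exact: le_trans (normr_ge0 _) (fg k Dx).
  apply: (@le_trans _ _ (series (g ^~ x) n.+1)).
    by rewrite /series/= big_nat_recr//= lerDr sumr_ge0.
  by apply: nondecreasing_cvgn_le (cg Dx) _; exact: nondecreasing_series.
have [il _ cv] : [/\ mu.-integrable D (fun x => (limn (series (f ^~ x)))%:E),
    (\int[mu]_(x in D) `|(series (f ^~ x) N)%:E - (limn (series (f ^~ x)))%:E|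
       @[N --> \oo] --> 0)%E &
    (\int[mu]_(x in D) (series (f ^~ x) N)%:E @[N --> \oo] -->
       \int[mu]_(x in D) (limn (series (f ^~ x)))%:E)%E].
  apply: (@dominated_convergence _ _ _ mu D mD _ _
    (fun x => (limn (series (g ^~ x)))%:E)) => //.
  - by move=> N; apply/measurable_EFinP; exact: mS.
  - by apply/measurable_EFinP; exact: dominated_series_measurable.
  - apply: aeW => x Dx; apply: cvg_EFin; first exact: nearW.
    exact: dominated_series_cvg (fun n => fg n Dx) (cg Dx).
  - apply: aeW => x N Dx; rewrite lee_fin.
    exact: dominated_series_partial (fun n => fg n Dx) (cg Dx) N.
have -> : series (fun n => \int[mu]_(x in D) f n x) =
    fine \o (fun N => \int[mu]_(x in D) (series (f ^~ x) N)%:E)%E.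
  apply/funext => N /=; rewrite /series/=.
  rewrite (_ : fine _ = \int[mu]_(x in D) \sum_(0 <= k < N) f k x)//.
  by rewrite Rintegral_sum.
apply: fine_cvg; rewrite fineK; last exact: integrable_fin_num.
exact: cv.
Qed.
End dominated_series.

(** * The kernel as a power series *)

Section hyp_series.
Context {R : realType}.
Variable sigma : R.
Hypothesis sigma_gt0 : 0 < sigma.

Definition hyp_series (y : R) : R := limn (series (fun n => hyp_coef sigma n * y ^+ n)).

(** It bounds [hyp_coef] by a multiple of 1 / n!, so that [hyp_series] converges
    by comparison with the exponential series. *)
Lemma rising_lower_bound n : 1 <= (1 + sigma^-1) * rising sigma n.
Proof.
have si : 0 < sigma^-1 by rewrite invr_gt0.
case: n => [|n]; first by rewrite rising0 mulr1 lerDl ltW.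
have h : sigma <= rising sigma n.+1.
  elim: n => [|n IH]; first by rewrite risingS rising0 mul1r addr0.
  rewrite risingS (le_trans IH)//; apply: ler_peMr; first exact/ltW/rising_gt0.
  by rewrite ler_wpDl ?(ltW sigma_gt0)// ler1n.
rewrite (@le_trans _ _ ((1 + sigma^-1) * sigma))//.
  by rewrite mulrDl mulVf ?gt_eqF// mul1r lerDr ltW.
by rewrite ler_pM2l// addr_gt0.
Qed.

Lemma hyp_coef_le n : hyp_coef sigma n <= (1 + sigma^-1) / n`!%:R.
Proof.
have f0 : 0 < n`!%:R :> R by rewrite ltr0n fact_gt0.
have r0 := rising_gt0 n sigma_gt0.
rewrite /hyp_coef invfM mulrC ler_pM2r ?invr_gt0//.
by rewrite -[leLHS]mul1r ler_pdivrMr// rising_lower_bound.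
Qed.

Lemma hyp_series_term_ge0 y n : 0 <= y -> 0 <= hyp_coef sigma n * y ^+ n.
Proof. by move=> y0; rewrite mulr_ge0 ?exprn_ge0// ltW// hyp_coef_gt0. Qed.

Lemma hyp_series_cvg y : 0 <= y -> cvgn (series (fun n => hyp_coef sigma n * y ^+ n)).
Proof.
move=> y0; have /(@is_cvg_seriesZ _ _ (1 + sigma^-1)) := is_cvg_series_exp_coeff y.
apply: series_le_cvg => n.
- exact: hyp_series_term_ge0.
- change (0 <= (1 + sigma^-1) * (y ^+ n / n`!%:R)).
  by rewrite mulr_ge0 ?addr_ge0 ?invr_ge0 ?(ltW sigma_gt0)// divr_ge0 ?exprn_ge0.
- change (hyp_coef sigma n * y ^+ n <= (1 + sigma^-1) * (y ^+ n / n`!%:R)).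
  rewrite mulrCA mulrC; apply: ler_wpM2l; first exact: exprn_ge0.
  exact: hyp_coef_le.
Qed.

Lemma hyp_series_ge0 y : 0 <= y -> 0 <= hyp_series y.
Proof.
move=> y0; apply: limr_ge; first exact: hyp_series_cvg.
by apply: nearW => N; apply: sumr_ge0 => n _; exact: hyp_series_term_ge0.
Qed.

(** Square the polynomial with coefficients p 0, ..., p (M - 1) and evaluate it
    at 1: its coefficients are truncated convolutions, at most the full ones. *)
Lemma sum_sqr_le (p : nat -> R) M : (forall n, 0 <= p n) ->
  (\sum_(0 <= i < M) p i) ^+ 2 <=
  \sum_(n < M.*2) \sum_(k < n.+1) p k * p (n - k)%N.
Proof.
move=> p0; pose q := \poly_(i < M) p i.
have qc k : 0 <= q`_k <= p k by rewrite coef_poly; case: ifP => _; rewrite ?p0 ?lexx.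
have -> : \sum_(0 <= i < M) p i = q.[1].
  rewrite big_mkord horner_poly; apply: eq_bigr => i _.
  by rewrite expr1n mulr1.
rewrite expr2 -hornerM (@horner_coef_wide _ M.*2); last first.
  rewrite (leq_trans (size_polyMleq _ _))//.
  rewrite (leq_trans (leq_pred _))// -addnn leq_add ?size_poly//.
apply: ler_sum => n _; rewrite expr1n mulr1 coefM; apply: ler_sum => k _.
have /andP[? ?] := qc k; have /andP[? ?] := qc (n - k)%N.
exact: ler_pM.
Qed.

Lemma hyp_series_sqr_le y : 0 <= y ->
  ((hyp_series y ^+ 2)%:E <= \sum_(0 <= n <oo) (hyp_sqr_coef sigma n * y ^+ n)%:E)%E.
Proof.
move=> y0.
have sq0 n : 0 <= hyp_sqr_coef sigma n * y ^+ n.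
  rewrite mulr_ge0 ?exprn_ge0// /hyp_sqr_coef sumr_ge0// => k _.
  by rewrite mulr_ge0// ltW// hyp_coef_gt0.
have cv : (series (fun n => hyp_coef sigma n * y ^+ n) N ^+ 2)%:E @[N --> \oo] -->
  (hyp_series y ^+ 2)%:E.
  apply: cvg_EFin; first exact: nearW.
  by rewrite expr2; apply: cvgM; exact: hyp_series_cvg.
rewrite -(cvg_lim _ cv)//; apply: lime_le; first by apply/cvg_ex; eexists; exact: cv.
apply: nearW => M.
apply: (@le_trans _ _ (\sum_(0 <= n < M.*2)
  (hyp_sqr_coef sigma n * y ^+ n)%:E)%E); last first.
  by apply: nneseries_lim_ge => n _; rewrite lee_fin.
rewrite sumEFin lee_fin /series/=.
apply: le_trans (sum_sqr_le _ _) _ => [n|]; first exact: hyp_series_term_ge0.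
rewrite big_mkord le_eqVlt; apply/orP; left; apply/eqP; apply: eq_bigr => n _.
rewrite /hyp_sqr_coef mulr_suml; apply: eq_bigr => k _.
have kn : (k <= n)%N by rewrite -ltnS.
by rewrite mulrACA -exprD subnKC.
Qed.
End hyp_series.

Section kernel.
Context {R : realType}.
Variables (sigma theta0 : R) (omega : R -> R).
Hypotheses (sigma_gt0 : 0 < sigma) (omega_adm : admissible omega).
Hypothesis Gamma_neq0 : Gamma sigma != 0.
Notation mu := (@lebesgue_measure R).
Notation D := (`[(-1 : R), 1]%classic : set R).

Lemma omega_ge0 s : D s -> 0 <= omega s.
Proof. by case: omega_adm => _ + _ _; apply. Qed.

Lemma measurable_omega : measurable_fun D omega.
Proof. by case: omega_adm. Qed.

Lemma omega_integrable : mu.-integrable D (EFin \o omega).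
Proof.
case: omega_adm => mo _ [M oM] _.
exact: (@bounded_measurable_integrable _ _ _ mu _ (@measurable_itvN11 R) _ M
  (@lebesgue_itvN11_fin R)).
Qed.

Lemma omega_int1 : \int[mu]_(s in D) omega s = 1.
Proof. by case: omega_adm => _ _ _; rewrite /Rintegral => ->. Qed.

Lemma omega_mul_integrable (h : R -> R) (B : R) : measurable_fun D h ->
  (forall s, D s -> `|h s| <= B) ->
  mu.-integrable D (EFin \o (fun s => omega s * h s)).
Proof.
move=> mh hB; have iB := integrableZr (@measurable_itvN11 R) B omega_integrable.
apply: le_integrable iB => //.
  by apply/measurable_EFinP; apply: measurable_funM => //; exact: measurable_omega.
move=> s Ds /=; rewrite lee_fin !normrM ler_wpM2l//.
by rewrite (le_trans (hB _ Ds))// ler_norm.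
Qed.

Lemma omega_mul_int_le1 (h : R -> R) : measurable_fun D h ->
  (forall s, D s -> `|h s| <= 1) -> `|\int[mu]_(s in D) (omega s * h s)| <= 1.
Proof.
move=> mh h1; have ih := omega_mul_integrable mh h1.
rewrite (le_trans (le_normr_Rintegral (@measurable_itvN11 R) ih))// -[leRHS]omega_int1.
apply: le_Rintegral => //; [exact: (integrable_norm ih)|exact: omega_integrable|].
move=> s Ds; rewrite normrM (ger0_norm (omega_ge0 Ds)).
by rewrite ler_piMr ?omega_ge0 ?h1.
Qed.

(** The n-th derivative of the cosine at t * s / (1 - theta0). *)
Definition phase (t s : R) (n : nat) : R := cos (pi / 2 * n%:R + t * s / (1 - theta0)).

Definition weight (t : R) (n : nat) : R :=
  \int[mu]_(s in D) (omega s * (s ^+ n * phase t s n)).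

Definition K_coef (t : R) (n : nat) : R := hyp_coef sigma n * (- t) ^+ n * weight t n.

Lemma measurable_phase t n : measurable_fun D (fun s => phase t s n).
Proof.
apply: measurable_funTS; rewrite /phase.
apply: measurableT_comp; first by apply: continuous_measurable_fun;
  exact: continuous_cos.
apply: measurable_funD => //; apply: measurable_funM => //.
Qed.

Lemma phase_weight_le t n s : D s -> `|s ^+ n * phase t s n| <= 1.
Proof.
rewrite /= in_itv/= => sD; rewrite normrM normrX mulr_ile1 ?exprn_ge0 ?cos_max//.
by rewrite exprn_ile1// ler_norml.
Qed.

Lemma measurable_phase_weight t n : measurable_fun D (fun s => s ^+ n * phase t s n).
Proof.
apply: measurable_funM; last exact: measurable_phase.
by apply: measurable_funX.
Qed.

Lemma weight_le1 t n : `|weight t n| <= 1.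
Proof.
apply: omega_mul_int_le1; first exact: measurable_phase_weight.
by move=> s; exact: phase_weight_le.
Qed.

Lemma K_coef_le t n : `|K_coef t n| <= hyp_coef sigma n * `|t| ^+ n.
Proof.
rewrite /K_coef !normrM normrX normrN ger0_norm ?(ltW (hyp_coef_gt0 _ _))//.
by rewrite ler_piMr ?weight_le1// hyp_series_term_ge0.
Qed.

Lemma K_termE t x s n : K_term sigma theta0 t x s n =
  hyp_coef sigma n * (- (t * x)) ^+ n * (s ^+ n * phase t s n).
Proof.
rewrite /K_term Gamma_rising// /hyp_coef -/(phase t s n).
rewrite (_ : - (t * s * x) = - (t * x) * s); last by ring.
have ? : n`!%:R != 0 :> R by rewrite pnatr_eq0 -lt0n fact_gt0.
have ? : rising sigma n != 0 by rewrite gt_eqF// rising_gt0.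
rewrite exprMn; move: ((- (t * x)) ^+ n) => ?; field.
by do 2 (apply/andP; split=> //).
Qed.

(** Integrating the series termwise in s separates the variables: all the
    dependence on x is now in the powers of x. *)
Lemma K_power_series t x :
  series (fun n => K_coef t n * x ^+ n) @ \oo --> K sigma theta0 omega t x.
Proof.
pose f n s := omega s * K_term sigma theta0 t x s n.
pose g n (s : R) := omega s * (hyp_coef sigma n * `|t * x| ^+ n).
have tx0 : 0 <= `|t * x| by [].
have cg s : series (g ^~ s) @ \oo --> omega s * hyp_series sigma `|t * x|.
  rewrite (_ : g ^~ s = (omega s *: (fun n => hyp_coef sigma n * `|t * x| ^+ n)));
    last by apply/funext.
  by rewrite seriesZ; apply: cvgZl_tmp; exact: hyp_series_cvg.
have KT_le s n : D s -> `|K_term sigma theta0 t x s n| <=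
  hyp_coef sigma n * `|t * x| ^+ n.
  move=> Ds; rewrite K_termE 2!normrM normrX normrN (ger0_norm (ltW
    (hyp_coef_gt0 _ _)))//.
  by rewrite ler_piMr ?phase_weight_le// hyp_series_term_ge0.
have mf n : measurable_fun D (f n).
  apply: measurable_funM; first exact: measurable_omega.
  rewrite (funext (fun s => K_termE t x s n)).
  by apply: measurable_funM => //; exact: measurable_phase_weight.
have fg n s : D s -> `|f n s| <= g n s.
  move=> Ds; rewrite normrM (ger0_norm (omega_ge0 Ds)).
  by apply: ler_wpM2l; [exact: omega_ge0|exact: KT_le].
have ig : mu.-integrable D (EFin \o (fun s => limn (series (g ^~ s)))).
  apply: (eq_integrable (@measurable_itvN11 R)
    (EFin \o (fun s => omega s * hyp_series sigma `|t * x|))).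
    by move=> s _ /=; rewrite (cvg_lim _ (cg s)).
  apply: (@omega_mul_integrable _ (hyp_series sigma `|t * x|)) => // s _.
  by rewrite ger0_norm ?hyp_series_ge0.
have := Rintegral_dominated_series (@measurable_itvN11 R) mf fg
  (fun s _ => cvgP _ (cg s)) ig.
rewrite (_ : (fun n => \int[mu]_(s in D) f n s) = (fun n => K_coef t n * x ^+ n)).
  rewrite (_ : \int[mu]_(s in D) _ = K sigma theta0 omega t x)//.
  apply: eq_Rintegral => s; rewrite inE => Ds.
  rewrite (_ : f ^~ s = omega s *: K_term sigma theta0 t x s); last exact/funext.
  rewrite lim_seriesZ//.
  exact: dominated_series_cvg (fun n => KT_le s n Ds) (hyp_series_cvg sigma_gt0 tx0).
apply/funext => n.
transitivity (\int[mu]_(s in D)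
    (hyp_coef sigma n * (- (t * x)) ^+ n * (omega s * (s ^+ n * phase t s n)))).
  by apply: eq_Rintegral => s _; rewrite /f K_termE mulrCA.
rewrite RintegralZl//; last first.
  by apply: (@omega_mul_integrable _ 1); [exact: measurable_phase_weight|exact:
    phase_weight_le].
by rewrite /K_coef -/(weight t n) -mulNr exprMn; ring.
Qed.

Lemma measurable_K t : measurable_fun setT (K sigma theta0 omega t).
Proof.
apply: (@measurable_fun_cvg _ R R setT
  (fun N x => series (fun n => K_coef t n * x ^+ n) N) (K sigma theta0 omega t)).
  move=> N; apply: measurable_sum => n; apply: measurable_funM => //.
by move=> x _; exact: K_power_series.
Qed.

Lemma K_term_le t x n : `|K_coef t n * x ^+ n| <= hyp_coef sigma n * (`|t| * `|x|) ^+ n.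
Proof. by rewrite normrM normrX exprMn mulrA ler_wpM2r ?exprn_ge0 ?K_coef_le. Qed.

Lemma K_le t x : `|K sigma theta0 omega t x| <= hyp_series sigma (`|t| * `|x|).
Proof.
rewrite -(cvg_lim _ (@K_power_series t x))//.
by apply: dominated_series_lim; [exact: K_term_le|apply: hyp_series_cvg;
  rewrite ?mulr_ge0].
Qed.

(** The Taylor expansion of the cosine at b, whose n-th derivative is a shift by
    n * pi / 2. *)
Lemma cos_taylor (u b : R) :
  series (fun n => (- u) ^+ n / n`!%:R * cos (pi / 2 * n%:R + b)) @ \oo --> cos (b - u).
Proof.
have trig n : cos (pi / 2 * n%:R : R) = (~~ odd n)%:R * (-1) ^+ n./2 /\
    sin (pi / 2 * n%:R : R) = (odd n)%:R * (-1) ^+ n.-1./2.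
  elim: n => [|n [IHc IHs]]; first by rewrite mulr0 cos0 sin0 /= mul1r mul0r.
  rewrite -[n.+1%:R]natr1 mulrDr mulr1 cosD sinD cos_pihalf sin_pihalf !mulr0 !mulr1
    sub0r add0r.
  rewrite IHc IHs /= uphalf_half negbK; split=> //.
  case: n {IHc IHs} => [|n] /=; first by rewrite !mul0r oppr0.
  rewrite uphalf_half; case: (odd n) => /=; rewrite ?mul0r ?oppr0// !mul1r.
  by rewrite add0n add1n exprS mulN1r.
have -> : cos (b - u) = cos (- u) * cos b - sin (- u) * sin b by rewrite addrC cosD.
have -> : series (fun n => (- u) ^+ n / n`!%:R * cos (pi / 2 * n%:R + b)) =
    (fun N => series (cos_coeff (- u)) N * cos b - series (sin_coeff (- u)) N * sin b).
  apply/funext => N; rewrite /series/= !mulr_suml -sumrB; apply: eq_bigr => n _.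
  have [c s] := trig n.
  by rewrite cosD c s /cos_coeff /sin_coeff/= -?exprnP; ring.
apply: cvgB; apply: cvgM; (try exact: cvg_cst).
- by rewrite unlock; exact: is_cvg_series_cos_coeff.
- by rewrite unlock; exact: is_cvg_series_sin_coeff.
Qed.
End kernel.

(** * First and second moments of the kernel *)

(** The second moment of [hyp_series sigma (|t| * |z|)] for z of parameter
    theta, as a function of tau = |t| / (1 - theta). *)
Definition second_moment_bound {R : realType} (sigma tau : R) : \bar R :=
  (\sum_(0 <= n <oo) (moment_coef sigma n * (4 * tau) ^+ n / n`!%:R)%:E)%E.

Lemma le_second_moment_bound {R : realType} (sigma tau tau' : R) : 0 < sigma ->
  0 <= tau -> tau <= tau' ->
  (second_moment_bound sigma tau <= second_moment_bound sigma tau')%E.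
Proof.
move=> s0 t0 tt'; apply: lee_nneseries => n _; rewrite lee_fin.
  by rewrite divr_ge0// mulr_ge0 ?moment_coef_ge0// exprn_ge0// mulr_ge0.
apply: ler_wpM2r; first by rewrite invr_ge0.
apply: ler_wpM2l; first exact: moment_coef_ge0.
by apply: lerXn2r; rewrite ?nnegrE; lra.
Qed.

Section kernel_moments.
Context {R : realType} d {T : measurableType d} (P : probability T R).
Variables (sigma theta0 theta : R) (omega : R -> R) (z : {RV P >-> R}).
Hypotheses (sigma_gt0 : 0 < sigma) (omega_adm : admissible omega).
Hypothesis theta_lt1 : theta < 1.
Hypothesis law : forall A : set R, measurable A ->
  distribution P z A = (\int[lebesgue_measure]_(x in A) (gamma_pdf sigma theta x)%:E)%E.
Notation mu := (@lebesgue_measure R).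
Notation D := (`[(-1 : R), 1]%classic : set R).
Variable t : R.
Local Notation tau := (`|t| / (1 - theta)).
Let c_gt0 : 0 < 1 - theta. Proof. by rewrite subr_gt0. Qed.
Let Gamma_neq0 : Gamma sigma != 0 := gamma_law_Gamma_neq0 law.
Local Notation Kz := (K sigma theta0 omega t \o z).
Local Notation Hz := (fun w => hyp_series sigma (`|t| * `|z w|)).

Lemma measurable_K_comp : measurable_fun setT Kz.
Proof.
have mK := measurable_K theta0 sigma_gt0 omega_adm Gamma_neq0 t.
exact: (measurableT_comp mK).
Qed.

Lemma measurable_hyp_series_comp : measurable_fun setT Hz.
Proof.
apply: (@measurable_fun_cvg _ T R setT
  (fun N w => series (fun n => hyp_coef sigma n * (`|t| * `|z w|) ^+ n) N) Hz).
  move=> N; apply: measurable_sum => n; apply: measurable_funM => //.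
  apply: measurable_funX; apply: measurable_funM => //.
  exact: measurableT_comp.
by move=> w _; apply: hyp_series_cvg; rewrite ?mulr_ge0.
Qed.

(** The square of the series has the coefficients [hyp_sqr_coef]; taking
    expectations multiplies the n-th one by [rising sigma n], which is what
    [moment_coef] contains. *)
Lemma hyp_series_sqr_expectation :
  (\int[P]_w (Hz w ^+ 2)%:E <= second_moment_bound sigma tau)%E.
Proof.
have sq0 n : 0 <= hyp_sqr_coef sigma n.
  by rewrite /hyp_sqr_coef sumr_ge0// => k _; rewrite mulr_ge0// ltW// hyp_coef_gt0.
apply: (@le_trans _ _ (\int[P]_w \sum_(0 <= n <oo)
    (hyp_sqr_coef sigma n * `|t| ^+ n * `|z w| ^+ n)%:E)%E).
  apply: ge0_le_integral => //.
  - by move=> w _; rewrite lee_fin sqr_ge0.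
  - by apply/measurable_EFinP/measurable_funX; exact: measurable_hyp_series_comp.
  - apply: ge0_emeasurable_sum => n.
      by move=> w _ _; rewrite lee_fin !mulr_ge0// exprn_ge0.
    move=> _; apply/measurable_EFinP; apply: measurable_funM => //.
    by apply: measurable_funX; exact: measurableT_comp.
  - move=> w _; have tz : 0 <= `|t| * `|z w| by rewrite mulr_ge0.
    apply: le_trans (hyp_series_sqr_le sigma_gt0 tz) _.
    apply: lee_nneseries => n _; rewrite lee_fin; first by rewrite mulr_ge0// exprn_ge0.
    by rewrite exprMn mulrA.
rewrite integral_nneseries//; last 2 first.
- move=> n; apply/measurable_EFinP; apply: measurable_funM => //.
  by apply: measurable_funX; exact: measurableT_comp.
- by move=> n w _; rewrite lee_fin !mulr_ge0// exprn_ge0.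
apply: lee_nneseries => n _.
  by move=> _; apply: integral_ge0 => w _; rewrite lee_fin !mulr_ge0// exprn_ge0.
under eq_integral do rewrite EFinM.
have mz : measurable_fun setT (fun w => (`|z w| ^+ n)%:E).
  by apply/measurable_EFinP; apply: measurable_funX; exact: measurableT_comp.
have z0 w : [set: T] w -> (0 <= (`|z w| ^+ n)%:E)%E by rewrite lee_fin exprn_ge0.
rewrite (ge0_integralZl P measurableT mz z0);
  last by rewrite lee_fin mulr_ge0// exprn_ge0.
rewrite (gamma_law_abs_moment sigma_gt0 theta_lt1 law) -EFinM lee_fin.
rewrite le_eqVlt; apply/orP; left; apply/eqP.
rewrite /moment_coef 2!exprMn exprVn.
have f0 : n`!%:R != 0 :> R by rewrite pnatr_eq0 -lt0n fact_gt0.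
have c0 : (1 - theta) ^+ n != 0 by rewrite expf_neq0 ?gt_eqF.
have p0 : (4 : R) ^+ n != 0 by rewrite expf_neq0.
by field; rewrite f0 c0 p0.
Qed.

Hypothesis second_moment_fin : (second_moment_bound sigma tau < +oo)%E.

Lemma K_sqr_expectation : (\int[P]_w (Kz w ^+ 2)%:E <= second_moment_bound sigma tau)%E.
Proof.
apply: le_trans hyp_series_sqr_expectation; apply: ge0_le_integral => //.
- by move=> w _; rewrite lee_fin sqr_ge0.
- by apply/measurable_EFinP/measurable_funX; exact: measurable_K_comp.
- by apply/measurable_EFinP/measurable_funX; exact: measurable_hyp_series_comp.
- move=> w _; rewrite lee_fin -real_normK ?num_real// lerXn2r ?nnegrE//.
    by apply: hyp_series_ge0; rewrite ?mulr_ge0.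
  exact: K_le.
Qed.

Lemma hyp_series_integrable : P.-integrable setT (EFin \o Hz).
Proof.
have Hz0 w : 0 <= Hz w by apply: hyp_series_ge0; rewrite ?mulr_ge0.
have isq : P.-integrable setT (EFin \o (fun w => 1 + Hz w ^+ 2)).
  apply: (@integrableD _ _ _ P setT measurableT (cst 1%E) (fun w => (Hz w ^+ 2)%:E)).
    exact: finite_measure_integrable_cst.
  apply/integrableP; split; first by apply/measurable_EFinP/measurable_funX;
    exact: measurable_hyp_series_comp.
  apply: le_lt_trans second_moment_fin; apply: le_trans hyp_series_sqr_expectation.
  by under eq_integral do rewrite gee0_abs ?lee_fin ?sqr_ge0//.
apply: le_integrable isq => //; first by apply/measurable_EFinP;
  exact: measurable_hyp_series_comp.
move=> w _ /=; have := Hz0 w; move: (hyp_series _ _) => h h0.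
rewrite lee_fin !ger0_norm ?addr_ge0 ?sqr_ge0//.
by have := sqr_ge0 (h - 1); nra.
Qed.

(** The moments of z cancel the rising factorials in [K_coef]; exchanging sum
    and integral back produces the series of [cos_taylor] under the integral. *)
Lemma K_expectation :
  \int[P]_w Kz w = \int[mu]_(s in D) (omega s * cos (t * (xi theta0 - xi theta) * s)).
Proof.
pose f n w := K_coef sigma theta0 omega t n * z w ^+ n.
pose g n w := hyp_coef sigma n * (`|t| * `|z w|) ^+ n.
have cvP : series (fun n => \int[P]_w f n w) @ \oo --> \int[P]_w Kz w.
  have := @Rintegral_dominated_series _ _ _ P setT measurableT f g.
  rewrite (_ : (fun w => limn (series (f ^~ w))) = Kz); last first.
    by apply/funext => w; exact/cvg_lim/K_power_series.
  apply.
  - move=> n; apply: measurable_funM => //; exact: measurable_funX.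
  - by move=> n w _; exact: K_term_le.
  - by move=> w _; apply: hyp_series_cvg; rewrite ?mulr_ge0.
  - exact: hyp_series_integrable.
pose u := t / (1 - theta).
pose h n s := omega s * ((- (u * s)) ^+ n / n`!%:R * phase theta0 t s n).
pose k n s := omega s * (`|u| ^+ n / n`!%:R).
have ck s : series (k ^~ s) @ \oo --> omega s * expR `|u|.
  rewrite (_ : k ^~ s = omega s *: exp_coeff `|u|); last exact/funext.
  by rewrite seriesZ; apply: cvgZl_tmp; exact: is_cvg_series_exp_coeff.
have hE n : h n = (fun s => omega s * ((- u) ^+ n / n`!%:R *
  (s ^+ n * phase theta0 t s n))).
  by apply/funext => s; rewrite /h -mulNr exprMn; congr (_ * _); ring.
have cvD : series (fun n => \int[mu]_(s in D) h n s) @ \oo -->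
    \int[mu]_(s in D) (omega s * cos (t * (xi theta0 - xi theta) * s)).
  have := @Rintegral_dominated_series _ _ _ mu D (@measurable_itvN11 R) h k.
  rewrite (_ : (fun s => limn (series (h ^~ s))) =
     (fun s => omega s * cos (t * (xi theta0 - xi theta) * s))); last first.
    apply/funext => s; apply/cvg_lim => //.
    rewrite (_ : h ^~ s = omega s *: (fun n =>
      (- (u * s)) ^+ n / n`!%:R * phase theta0 t s n)); last exact/funext.
    rewrite seriesZ; apply: cvgZl_tmp.
    rewrite (_ : t * (xi theta0 - xi theta) * s = t * s / (1 - theta0) - u * s);
      last first.
      by rewrite /u /xi; ring.
    exact: cos_taylor.
  apply.
  - move=> n; rewrite hE; apply: measurable_funM; first exact: measurable_omega.
    by apply: measurable_funM => //; exact: measurable_phase_weight.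
  - move=> n s Ds; rewrite hE normrM (ger0_norm (omega_ge0 omega_adm Ds)).
    apply: ler_wpM2l; first exact: omega_ge0.
    rewrite normrM normrM normrX normrN normfV (ger0_norm (ler0n _ _)).
    by rewrite ler_piMr ?phase_weight_le// divr_ge0// exprn_ge0.
  - by move=> s _; exact: cvgP (ck s).
  - rewrite (_ : EFin \o _ = EFin \o (fun s => omega s * expR `|u|)); last first.
      by apply/funext => s /=; rewrite (cvg_lim _ (ck s)).
    apply: (@omega_mul_integrable _ _ omega_adm _ (expR `|u|)) => // s _.
    by rewrite ger0_norm ?expR_ge0.
apply: (cvg_unique _ cvP) => //.
rewrite (_ : (fun n => \int[P]_w f n w) = (fun n => \int[mu]_(s in D) h n s))//.
apply/funext => n; rewrite hE /f RintegralZl//; last first.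
  exact: (gamma_law_moment_integrable sigma_gt0 theta_lt1 law).
rewrite {1}/Rintegral (gamma_law_moment sigma_gt0 theta_lt1 law) /=.
transitivity (\int[mu]_(s in D)
    ((- u) ^+ n / n`!%:R * (omega s * (s ^+ n * phase theta0 t s n)))).
  rewrite RintegralZl//; last first.
    apply: (@omega_mul_integrable _ _ omega_adm _ 1);
      first exact: measurable_phase_weight.
    exact: phase_weight_le.
  rewrite -/(weight theta0 omega t n) /K_coef /hyp_coef /u -mulNr exprMn exprVn.
  have f0 : n`!%:R != 0 :> R by rewrite pnatr_eq0 -lt0n fact_gt0.
  have c0 : (1 - theta) ^+ n != 0 by rewrite expf_neq0 ?gt_eqF.
  have r0 : rising sigma n != 0 by rewrite gt_eqF ?rising_gt0.
  by field; rewrite f0 c0 r0.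
by apply: eq_Rintegral => s _; rewrite mulrCA.
Qed.
End kernel_moments.

(** * Independence and the Chebyshev inequality *)

Section independence.
Context {R : realType} d {T : measurableType d} (P : probability T R).

Definition pair_independent (X Y : T -> R) : Prop := forall A B : set R,
  measurable A -> measurable B ->
  P (X @^-1` A `&` Y @^-1` B) = (P (X @^-1` A) * P (Y @^-1` B))%E.

Lemma mutually_independent_pair m (z : 'I_m -> {RV P >-> R}) (i j : 'I_m) :
  mutually_independent z -> i != j -> pair_independent (z i) (z j).
Proof.
move=> ind ij A B mA mB.
pose C k := if k == i then A else if k == j then B else [set: R].
have := ind C; rewrite (_ : [set w | _] = z i @^-1` A `&` z j @^-1` B).
  move=> ->; last by move=> k; rewrite /C; case: ifP => // _; case: ifP.
  have ji : (j == i) = false by rewrite eq_sym (negbTE ij).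
  rewrite (bigD1 i)//= (bigD1 j) ?ji//= big1 ?mule1.
    by rewrite /C eqxx ji eqxx.
  move=> k /andP[ki kj]; rewrite /C (negbTE ki) (negbTE kj) preimage_setT.
  exact: probability_setT.
apply/seteqP; split=> w /=.
  move=> h; have := h i; have := h j; rewrite /C !eqxx.
  by rewrite eq_sym (negbTE ij).
move=> [hi hj] k; rewrite /C; case: eqP => [->//|_]; case: eqP => [->//|_].
by [].
Qed.

Lemma pair_independent_comp (X Y : T -> R) (f g : R -> R) :
  measurable_fun setT f -> measurable_fun setT g ->
  pair_independent X Y -> pair_independent (f \o X) (g \o Y).
Proof.
move=> mf mg ind A B mA mB; apply: (ind (f @^-1` A) (g @^-1` B)).
  by rewrite -[X in measurable X]setTI; exact: mf.
by rewrite -[X in measurable X]setTI; exact: mg.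
Qed.

(** Independence says that the law of (X, Y) is the product measure on
    rectangles, hence everywhere; then Fubini applies. *)
Lemma independent_expectationM (X Y : {RV P >-> R}) : pair_independent X Y ->
  P.-integrable setT (EFin \o X) -> P.-integrable setT (EFin \o Y) ->
  P.-integrable setT (EFin \o (fun w => X w * Y w)) ->
  \int[P]_w (X w * Y w) = (\int[P]_w X w) * (\int[P]_w Y w).
Proof.
move=> ind iX iY iXY.
have mXY : measurable_fun setT (fun w => (X w, Y w)) by exact: measurable_fun_pair.
pose XY : {RV P >-> (R * R)%type} := mfun_Sub (mem_set mXY).
pose m1 : probability R R := distribution P X.
pose m2 : probability R R := distribution P Y.
pose m12 : probability (R * R)%type R := distribution P XY.
have prodE S : measurable S -> (m1 \x m2)%E S = m12 S.
  by apply: product_measure_unique => A B mA mB; exact: ind.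
pose f (u : R * R) := (u.1 * u.2)%:E.
have mf : measurable_fun setT f by apply/measurable_EFinP; exact: measurable_funM.
have i12 : m12.-integrable setT f by exact: integrable_pushforward.
have ip : (m1 \x m2)%E.-integrable setT f.
  apply/integrableP; split => //.
  rewrite (eq_measure_integral m12); last by move=> S mS _; exact: prodE.
  by case/integrableP: i12.
have i1 : m1.-integrable setT (EFin : R -> \bar R) by exact: integrable_pushforward.
have i2 : m2.-integrable setT (EFin : R -> \bar R) by exact: integrable_pushforward.
have E1 : (\int[m1]_x x%:E = \int[P]_w (X w)%:E)%E by exact: integral_distribution.
have E2 : (\int[m2]_x x%:E = \int[P]_w (Y w)%:E)%E by exact: integral_distribution.
have key : (\int[P]_w (X w * Y w)%:E = (\int[P]_w (X w)%:E) * (\int[P]_w (Y w)%:E))%E.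
  transitivity (\int[m12]_u f u)%E; first by symmetry; exact: integral_distribution.
  rewrite (eq_measure_integral (m1 \x m2)%E); last by move=> S mS _; exact/esym/prodE.
  rewrite -integral12_prod_meas1// /fubini_F.
  under eq_integral => x _.
    rewrite /f/=; under eq_integral do rewrite EFinM.
    rewrite integralZl//; over.
  rewrite /= E2 -E1.
  rewrite -[X in (\int[_]_x (_ * X))%E](@fineK _ (\int[P]_w (Y w)%:E)%E);
    last exact: integrable_fin_num.
  by rewrite integralZr// fineK// integrable_fin_num.
by rewrite /Rintegral key fineM// integrable_fin_num.
Qed.

Lemma sqr_integrable_mul (X Y : T -> R) :
  measurable_fun setT X -> measurable_fun setT Y ->
  P.-integrable setT (EFin \o (fun w => X w ^+ 2)) ->
  P.-integrable setT (EFin \o (fun w => Y w ^+ 2)) ->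
  P.-integrable setT (EFin \o (fun w => X w * Y w)).
Proof.
move=> mX mY iX iY; have iXY := integrableD measurableT iX iY.
apply: le_integrable iXY => //; first by apply/measurable_EFinP; exact: measurable_funM.
move=> w _ /=; rewrite lee_fin [leRHS]ger0_norm ?addr_ge0 ?sqr_ge0//.
rewrite normrM -(real_normK (num_real (X w))) -(real_normK (num_real (Y w))).
have := sqr_ge0 (`|X w| - `|Y w|).
have := normr_ge0 (X w); have := normr_ge0 (Y w).
move: `|X w| `|Y w| => a b; nra.
Qed.

Lemma sqr_integrable_integrable (X : T -> R) : measurable_fun setT X ->
  P.-integrable setT (EFin \o (fun w => X w ^+ 2)) ->
  P.-integrable setT (EFin \o X).
Proof.
move=> mX iX; have i1 : P.-integrable setT (EFin \o (fun w : T => (1 : R) ^+ 2)).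
  exact: finite_measure_integrable_cst.
have := sqr_integrable_mul mX (@measurable_cst _ _ T R setT 1) iX i1.
by apply: eq_integrable => // w _ /=; rewrite mulr1.
Qed.

(** Chebyshev's inequality, with each variance bounded by the second moment: the
    covariances of distinct summands vanish. *)
Lemma chebyshev_sum (m : nat) (X : 'I_m -> {RV P >-> R}) (V : 'I_m -> R) (a : R) :
  (forall i j, i != j -> pair_independent (X i) (X j)) ->
  (forall i, (\int[P]_w (X i w ^+ 2)%:E <= (V i)%:E)%E) ->
  0 < a ->
  (P [set w | (a <= `|\sum_(i < m) (X i w - \int[P]_w X i w)|)%R] <=
   (\sum_(i < m) V i / a ^+ 2)%R%:E)%E.
Proof.
move=> ind XV a0.
pose e i := \int[P]_w X i w.
have mX i : measurable_fun setT (X i) by exact: measurable_funPT.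
have isq i : P.-integrable setT (EFin \o (fun w => X i w ^+ 2)).
  apply/integrableP; split; first by apply/measurable_EFinP; exact: measurable_funX.
  apply: (@le_lt_trans _ _ (V i)%:E); last exact: ltry.
  by under eq_integral do rewrite /= ger0_norm ?sqr_ge0//.
have iX i : P.-integrable setT (EFin \o X i) by exact: sqr_integrable_integrable.
have mY i : measurable_fun setT (fun w => X i w - e i) by exact: measurable_funB.
pose Y i : {RV P >-> R} := mfun_Sub (mem_set (mY i)).
have YE i w : Y i w = X i w - e i by [].
have icst (c : R) : P.-integrable setT (EFin \o (fun=> c) : T -> \bar R).
  exact: finite_measure_integrable_cst.
have iY i : P.-integrable setT (EFin \o Y i).
  exact: (integrableB measurableT (iX i) (icst (e i))).
have EY i : \int[P]_w Y i w = 0.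
  rewrite (RintegralB measurableT (iX i) (icst (e i))) Rintegral_cst//.
  by rewrite [X in fine X]probability_setT mulr1 subrr.
have iYq i : P.-integrable setT (EFin \o (fun w => Y i w ^+ 2)).
  have i2 := integrableD measurableT (isq i)
    (integrableD measurableT (integrableZl measurableT (- 2 * e i) (iX i))
       (icst (e i ^+ 2))).
  apply: eq_integrable i2 => // w _; rewrite /= -!EFinM -!EFinD.
  by congr (_%:E); ring.
have EYq i : \int[P]_w (Y i w ^+ 2) <= V i.
  have -> : \int[P]_w (Y i w ^+ 2) = \int[P]_w (X i w ^+ 2) - e i ^+ 2.
    transitivity (\int[P]_w (X i w ^+ 2 + ((- 2 * e i) * X i w + e i ^+ 2))).
      by apply: eq_Rintegral => w _; rewrite YE; ring.
    rewrite RintegralD//; last exact: (integrableD measurableT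
      (integrableZl measurableT (- 2 * e i) (iX i)) (icst (e i ^+ 2))).
    rewrite RintegralD//; last exact: (integrableZl measurableT (- 2 * e i) (iX i)).
    rewrite RintegralZl// Rintegral_cst// [X in fine X]probability_setT -/(e i) /=;
      ring.
  rewrite lerBlDr ler_wpDr ?sqr_ge0// -lee_fin /Rintegral fineK ?XV//.
  exact: integrable_fin_num (isq i).
have iYY i j : P.-integrable setT (EFin \o (fun w => Y i w * Y j w)).
  exact: sqr_integrable_mul.
pose S w := \sum_(i < m) Y i w.
have mS : measurable_fun setT S by exact: measurable_sum.
have S2E w : S w ^+ 2 = \sum_(i < m) \sum_(j < m) Y i w * Y j w.
  rewrite /S expr2 mulr_suml; apply: eq_bigr => i _.
  by rewrite mulr_sumr.
have iS2 : P.-integrable setT (EFin \o (fun w => S w ^+ 2)).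
  rewrite (funext S2E); apply: integrable_sum_EFin => // i.
  exact: integrable_sum_EFin.
have ES2 : \int[P]_w (S w ^+ 2) <= \sum_(i < m) V i.
  rewrite (funext S2E) Rintegral_sum//; last by move=> i; exact: integrable_sum_EFin.
  apply: ler_sum => i _; rewrite Rintegral_sum//.
  rewrite (bigD1 i)// big1 ?addr0.
    by rewrite [leLHS]addr0; exact: EYq.
  move=> j /andP[_ ji]; rewrite independent_expectationM// ?EY ?mul0r//.
  have mB (c : R) : measurable_fun setT (fun x : R => x - c) by exact: measurable_funB.
  by apply: (pair_independent_comp (mB (e i)) (mB (e j))); apply: ind; rewrite eq_sym.
pose SR : {RV P >-> R} := mfun_Sub (mem_set mS).
have := @markov _ _ _ P SR (fun x => x ^+ 2) a a0
  (measurable_funX 2 (@measurable_id _ _ _)).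
have h1 : forall r : R, 0 <= r -> 0 <= r ^+ 2 by move=> r _; exact: sqr_ge0.
have h2 : {in Num.nneg &, {homo (fun x : R => x ^+ 2) : x y / x <= y}}.
  by move=> x y x0 y0 xy; rewrite lerXn2r.
move=> /(_ h1 h2) mk.
rewrite -mulr_suml mulrC EFinM lee_pdivlMl ?exprn_gt0//.
apply: le_trans mk _.
rewrite unlock (_ : (\int[P]_w _)%E = (\int[P]_w (S w ^+ 2))%:E) ?lee_fin//.
rewrite /Rintegral fineK; last exact: integrable_fin_num iS2.
by apply: eq_integral => w _ /=; rewrite real_normK ?num_real.
Qed.
End independence.

(** * Uniform consistency *)

Section parameters.
Context {R : realType}.

Lemma lnm_ge0 n : 0 <= @lnm R n.
Proof. by rewrite /lnm ln_ge0// ler1n. Qed.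

Lemma lnm_diverges (M : R) : \forall n \near \oo, M <= lnm n.
Proof.
near=> n; rewrite /lnm -ler_expR lnK ?posrE//.
apply: (@le_trans _ _ n%:R); last by rewrite ler_nat.
by near: n; exact: nbhs_infty_ger.
Unshelve. all: by end_near. Qed.

Lemma u3_le n (theta : 'rV[R]_n.+1) i : u3 theta <= 1 - theta 0 i.
Proof. exact: bigmin_le. Qed.

Lemma u3_gt0 n (theta : 'rV[R]_n.+1) : (forall i, theta 0 i < 1) -> 0 < u3 theta.
Proof.
by move=> th1; apply: lt_bigmin => [|i _]; rewrite subr_gt0.
Qed.

(** The parameters are bounded by rho, which keeps [u3], and with it t / ln m,
    bounded. *)
Lemma u3_le_norm n (theta : 'rV[R]_n.+1) (rho : R) :
  `|theta| <= rho -> u3 theta <= 1 + rho.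
Proof.
move=> thr; rewrite (le_trans (u3_le theta ord0))// lerD2l.
rewrite (le_trans (ler_norm _))// normrN (le_trans _ thr)//.
rewrite [leRHS]mx_normrE.
exact: (le_bigmax _ (fun ij : 'I_1 * 'I_n.+1 => `|theta ij.1 ij.2|) (ord0, ord0)).
Qed.

Lemma min_sep_le (theta0 : R) m (theta : 'rV[R]_m) i : theta 0 i != theta0 ->
  (min_sep theta0 theta <= `|xi theta0 - xi (theta 0 i)|%:E)%E.
Proof. by move=> ti; apply: bigmin_le_cond; rewrite inE. Qed.

Lemma pi1E (theta0 : R) n (theta : 'rV[R]_n.+1) :
  n.+1%:R * pi1 theta0 theta = #|I1 theta0 theta|%:R.
Proof. by rewrite /pi1 mulrCA mulfV ?mulr1// pnatr_eq0. Qed.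
End parameters.

Section consistency.
Context {R : realType}.
Variables (sigma theta0 : R) (omega : R -> R).
Hypotheses (sigma_gt0 : 0 < sigma) (omega_adm : admissible omega).
Notation mu := (@lebesgue_measure R).
Notation D := (`[(-1 : R), 1]%classic : set R).

(** The mean of [K t z] is its value at l = t * (xi theta0 - xi theta). *)
Definition cos_transform (l : R) : R := \int[mu]_(s in D) (omega s * cos (l * s)).

Lemma cos_transform0 : cos_transform 0 = 1.
Proof.
rewrite -(omega_int1 omega_adm); apply: eq_Rintegral => s _.
by rewrite mul0r cos0 mulr1.
Qed.

(** The relative error of the estimator is a centred independent sum plus the
    cosine transforms of the observations with theta i <> theta0, divided by
    m * pi1.  Chebyshev's inequality handles the former, the hypothesis on
    [cos_transform] the latter. *)
Lemma phihat_deviation n (theta : 'rV[R]_n.+1) (t eps V : R)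
    d (T : measurableType d) (P : probability T R) (z : 'I_n.+1 -> {RV P >-> R}) :
  (forall i, theta 0 i < 1) -> 0 < pi1 theta0 theta -> 0 < eps ->
  gamma_sample sigma theta z ->
  (forall i, theta 0 i != theta0 ->
     `|cos_transform (t * (xi theta0 - xi (theta 0 i)))| <= eps / 2) ->
  (forall i, (second_moment_bound sigma (`|t| / (1 - theta 0%R i)) <= V%:E)%E) ->
  ((1 - 4 * V / (n.+1%:R * (eps * pi1 theta0 theta) ^+ 2))%:E <=
    P [set w | (`|(pi1 theta0 theta)^-1 *
      phihat sigma theta0 omega t (fun i => z i w) - 1| <= eps)%R])%E.
Proof.
move=> th1 pi0 eps0 [ind law] RL sqV.
pose est w : R := (pi1 theta0 theta)^-1 * phihat sigma theta0 omega t (fun i => z i w).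
rewrite -[X in P X]/[set w | (`|est w - 1| <= eps)%R].
have G0 : Gamma sigma != 0 by exact: gamma_law_Gamma_neq0 (law ord0).
have mK := measurable_K theta0 sigma_gt0 omega_adm G0 t.
have mX i : measurable_fun setT (K sigma theta0 omega t \o z i).
  exact: (measurableT_comp mK).
pose X i : {RV P >-> R} := mfun_Sub (mem_set (mX i)).
have EX i : \int[P]_w X i w = cos_transform (t * (xi theta0 - xi (theta 0 i))).
  have fin : (second_moment_bound sigma (`|t| / (1 - theta 0%R i)) < +oo)%E
    by exact: le_lt_trans (sqV i) (ltry _).
  exact: (K_expectation theta0 sigma_gt0 omega_adm (th1 i) (law i) fin).
have X2 i : (\int[P]_w (X i w ^+ 2)%:E <= V%:E)%E.
  apply: le_trans (sqV i).
  exact: (K_sqr_expectation theta0 sigma_gt0 omega_adm (th1 i) (law i)).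
pose m : R := n.+1%:R; have m0 : 0 < m by rewrite ltr0n.
pose k : R := #|I1 theta0 theta|%:R.
have kE : k = m * pi1 theta0 theta by rewrite /k -pi1E.
have k0 : 0 < k by rewrite kE mulr_gt0.
have mest : measurable_fun setT est.
  apply: measurable_funM => //; apply: measurable_funM => //.
  apply: measurable_sum => i; apply: measurable_funB => //; exact: mX.
have mS : measurable [set w | `|est w - 1| <= eps].
  have mh : measurable_fun setT (fun w => `|est w - 1|).
    by apply: measurableT_comp => //; exact: measurable_funB.
  rewrite (_ : [set w | _] = setT `&` (fun w => `|est w - 1|) @^-1` `]-oo, eps]).
    exact: mh.
  by rewrite setTI; apply/seteqP; split=> w /=; rewrite in_itv.
(* Half of eps is for the centred sum, the other half for the cosine transforms. *)
pose a := k * eps / 2; have a0 : 0 < a by rewrite divr_gt0// mulr_gt0.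
have cheb : (P [set w | (a <= `|\sum_(i < n.+1) (X i w - \int[P]_w X i w)|)%R] <=
    (\sum_(i < n.+1) V / a ^+ 2)%R%:E)%E.
  apply: chebyshev_sum => // i j ij.
  apply: (pair_independent_comp mK mK); exact: mutually_independent_pair.
set B := [set w | (a <= _)%R] in cheb.
have mB : measurable B.
  have mh : measurable_fun setT (fun w => `|\sum_(i < n.+1) (X i w - \int[P]_w X i w)|).
    apply: measurableT_comp => //; apply: measurable_sum => i.
    by apply: measurable_funB => //; exact: mX.
  rewrite (_ : B = setT `&` (fun w =>
    `|\sum_(i < n.+1) (X i w - \int[P]_w X i w)|) @^-1` `[a, +oo[).
    exact: mh.
  by rewrite setTI; apply/seteqP; split=> w; rewrite /B/= in_itv/= andbT.
apply: (@le_trans _ _ (P (~` B))); last first.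
  apply: le_measure; rewrite ?inE//; first exact: measurableC.
  move=> w /= /negP; rewrite -ltNge => Bw.
  have estE : est w - 1 = - k^-1 * (\sum_(i < n.+1) (X i w - \int[P]_w X i w) +
      \sum_(i in I1 theta0 theta) cos_transform (t * (xi theta0 - xi (theta 0 i)))).
    (* Each observation outside [I1] contributes the value 1 at frequency 0. *)
    have sE : \sum_(i < n.+1) \int[P]_w X i w =
        m - k + \sum_(i in I1 theta0 theta) cos_transform (t * (xi theta0 - xi
          (theta 0 i))).
      rewrite (eq_bigr _ (fun i _ => EX i)) (bigID (mem (I1 theta0 theta)))/= addrC.
      congr (_ + _).
      rewrite (eq_bigr (fun=> 1)); last first.
        move=> i; rewrite inE negbK => /eqP ->.
        by rewrite subrr mulr0 cos_transform0.
      rewrite sumr_const; apply/eqP; rewrite eq_sym subr_eq -natrD; apply/eqP.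
      congr (_%:R).
      by rewrite -[LHS]card_ord -(cardC (mem (I1 theta0 theta))) addnC.
    rewrite /est /phihat sumrB sumr_const card_ord sumrB sE.
    have -> : (pi1 theta0 theta)^-1 = m / k.
      by rewrite kE; field; rewrite !gt_eqF.
    rewrite -/m; field; rewrite !gt_eqF//.
  rewrite estE normrM normrN normfV (gtr0_norm k0) ler_pdivrMl//.
  apply: (le_trans (ler_normD _ _)).
  rewrite (_ : k * eps = a + k * (eps / 2)); last by rewrite /a; field.
  apply: lerD; first exact: ltW.
  apply: (le_trans (ler_norm_sum _ _ _)).
  rewrite /k mulr_natl -sumr_const; apply: ler_sum => i; rewrite inE => ti.
  exact: RL.
rewrite probability_setC//.
apply: (@le_trans _ _ (1 - (\sum_(i < n.+1) V / a ^+ 2)%R%:E)%E); last first.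
  by apply: leeB.
rewrite -EFinB lee_fin lerD2l lerN2 sumr_const card_ord -mulr_natl -/m.
rewrite /a kE le_eqVlt; apply/orP; left; apply/eqP; field.
by rewrite !gt_eqF.
Qed.

(** The two versions of the class enter only through the convergence
    hypothesis on [moment_coef]: it makes the variance of the estimator
    negligible against m ^ (gamma' - 1), the lower bound for pi1 ^ 2. *)
Lemma uniform_consistency rho gamma gamma' (Q : set_seq R) :
  0 < gamma -> gamma <= gamma' ->
  moment_coef sigma n / (gamma' / gamma) ^+ n @[n --> \oo] --> 0 ->
  QIII_base theta0 rho gamma gamma' Q ->
  uniform_consistency_class sigma theta0 omega Q.
Proof.
move=> g0 gg' coef0 [base sep] eps delta eps0 delta0.
have g'0 : 0 < gamma' by exact: lt_le_trans gg'.
set p := gamma' / gamma in coef0.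
have p0 : 0 < p by rewrite divr_gt0.
have eps20 : 0 < eps / 2 by rewrite divr_gt0.
have [M oM] : exists M, forall s, D s -> `|omega s| <= M.
  by case: omega_adm => _ _ [M oM] _; exists M.
have [A A0 RL] := riemann_lebesgue (measurable_omega omega_adm) oM eps20.
(* Chebyshev's inequality leaves the probability 4 * e' / eps ^ 2 = delta. *)
pose e' := delta * eps ^+ 2 / 4.
have e'0 : 0 < e' by rewrite divr_gt0// mulr_gt0// exprn_gt0.
have b0 n : 0 <= moment_coef sigma n / p ^+ n.
  by rewrite divr_ge0 ?moment_coef_ge0// exprn_ge0// ltW.
have [x0 [_ little]] := exp_series_little_o b0 coef0 e'0.
have sepA := sep A.
near=> n => theta [t Qt] d T P z sample.
have nl : x0 < gamma' * lnm n.
  rewrite -ltr_pdivrMl//; near: n.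
  have := lnm_diverges (gamma'^-1 * x0 + 1); apply: filterS => n.
  by apply: lt_le_trans; rewrite ltrDl.
have sepn : forall (theta : 'rV[R]_n.+1) (t : R), Q n (theta, t) ->
    (A%:E <= t%:E * min_sep theta0 theta)%E by near: n; exact: sepA.
have [th1 thr tE pi_ge] := base _ _ _ Qt.
have u0 := u3_gt0 th1.
pose l : R := lnm n; have l0 : 0 <= l by exact: lnm_ge0.
have lE : expR l = n.+1%:R by rewrite /l /lnm lnK// posrE.
have t0 : 0 <= t by rewrite tE !mulr_ge0// ltW.
have pi0 : 0 < pi1 theta0 theta by apply: lt_le_trans pi_ge; exact: powR_gt0.
(* A common bound for t / (1 - theta i), by the choice of t and u3 <= 1 - theta i. *)
pose L := gamma / 4 * l.
have L0 : 0 <= L by rewrite mulr_ge0// divr_ge0// ltW.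
pose V := e' * expR (gamma' * l).
have sqL : (second_moment_bound sigma L <= V%:E)%E.
  apply: (le_trans _ (little (gamma' * l) nl)).
  apply: lee_nneseries => k _; rewrite lee_fin.
    by move=> _; rewrite divr_ge0// mulr_ge0 ?moment_coef_ge0// exprn_ge0// mulr_ge0.
  rewrite (_ : gamma' * l = p * (4 * L)); last first.
    by rewrite /p /L; field; rewrite gt_eqF.
  have pk : p ^+ k != 0 by rewrite expf_neq0// gt_eqF.
  by rewrite [(p * (4 * L)) ^+ k]exprMn (mulrA _ (p ^+ k)) divfK.
have sqV i : (second_moment_bound sigma (`|t| / (1 - theta 0%R i)) <= V%:E)%E.
  have ti : 0 < 1 - theta 0 i by rewrite subr_gt0.
  apply: le_trans sqL; apply: le_second_moment_bound => //;
    first by rewrite divr_ge0// ltW.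
  rewrite ger0_norm// ler_pdivrMr// tE -/l /L.
  rewrite (_ : gamma / 4 * l * (1 - theta 0 i) =
    4^-1 * gamma * (1 - theta 0 i) * l); last by ring.
  by rewrite ler_wpM2r// ler_wpM2l ?u3_le// mulr_ge0// ltW.
have RLi i : theta 0 i != theta0 ->
    `|cos_transform (t * (xi theta0 - xi (theta 0 i)))| <= eps / 2.
  move=> ti; apply: RL; rewrite normrM (ger0_norm t0) -lee_fin EFinM.
  apply: le_trans (lee_wpmul2l _ (min_sep_le ti)); last by rewrite lee_fin.
  by apply: sepn Qt.
have dev := phihat_deviation th1 pi0 eps0 sample RLi sqV.
apply: (@le_trans _ _ (1 - 4 * V / (n.+1%:R * (eps * pi1 theta0 theta) ^+ 2))%:E).
  have d0 : 0 < n.+1%:R * (eps * pi1 theta0 theta) ^+ 2.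
    by apply: mulr_gt0 => //; exact: exprn_gt0 (mulr_gt0 eps0 pi0).
  rewrite lee_fin lerD2l lerN2 ler_pdivrMr//.
  have key : expR (gamma' * l) <= n.+1%:R * pi1 theta0 theta ^+ 2.
    have -> : expR (gamma' * l) = expR l * (n.+1%:R `^ ((gamma' - 1) / 2)) ^+ 2.
      by rewrite /powR pnatr_eq0/= -/(lnm n) -/l expr2 -!expRD; congr expR; field.
    rewrite lE ler_pM2l ?ltr0n//; apply: lerXn2r => //; rewrite nnegrE ?powR_ge0//.
    exact: ltW.
  rewrite [leLHS](_ : _ = delta * eps ^+ 2 * expR (gamma' * l));
    last by rewrite /V /e'; field.
  rewrite [leRHS](_ : _ = delta * eps ^+ 2 * (n.+1%:R * pi1 theta0 theta ^+ 2));
    last by ring.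
  by apply: ler_wpM2l => //; rewrite mulr_ge0 ?(ltW delta0)// sqr_ge0.
apply: (le_trans dev); rewrite le_eqVlt; apply/orP; left; apply/eqP.
congr (P _).
(* The class fixes t as a function of theta, so there is a single value. *)
have setE w : ereal_sup [set (phihat sigma theta0 omega s (fun i =>
  z i w))%:E | s in [set s | Q n (theta, s)]] =
    (phihat sigma theta0 omega t (fun i => z i w))%:E.
  rewrite (_ : [set _ | _ in _] = [set (phihat sigma theta0 omega t (fun i =>
    z i w))%:E]) ?ereal_sup1//.
  apply/seteqP; split=> y /=.
    by move=> [s Qs <-]; have [_ _ -> _] := base _ _ _ Qs; rewrite -tE.
  by move=> ->; exists t.
by apply/funext => w /=; rewrite setE -EFinM -EFinB abse_EFin lee_fin.
Unshelve. all: by end_near. Qed.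
End consistency.

Section speed.
Context {R : realType}.
Variables (theta0 rho gamma gamma' : R) (Q : set_seq R).
Hypotheses (rho_gt0 : 0 < rho) (gamma_gt0 : 0 < gamma).
Hypothesis base : QIII_base theta0 rho gamma gamma' Q.

Lemma QIII_poly_log_speed : poly_log_speed Q.
Proof.
have [bQ _] := base; have g4 : 0 < 4^-1 * gamma by rewrite mulr_gt0.
exists 1 => //; split.
- exists (4^-1 * gamma * (1 + rho)); first by rewrite mulr_gt0// addr_gt0.
  apply: nearW => n theta t /bQ[th1 thr -> _].
  have u0 := ltW (u3_gt0 th1).
  rewrite powRr1 ?lnm_ge0// ger0_norm; last first.
    by rewrite mulr_ge0 ?lnm_ge0// mulr_ge0// ltW.
  apply: ler_wpM2r; first exact: lnm_ge0.
  by apply: ler_wpM2l; [exact: ltW|exact: u3_le_norm].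
- move=> [u u0 uQ]; exists (4^-1 * gamma * u); first by rewrite mulr_gt0.
  apply: nearW => n theta t Qt; have [_ _ -> _] := bQ _ _ _ Qt.
  rewrite powRr1 ?lnm_ge0//; apply: ler_wpM2r; first exact: lnm_ge0.
  by apply: ler_wpM2l; [exact: ltW|exact: uQ Qt].
Qed.

Lemma QIII_t_diverges :
  diverges_on Q (fun n theta t => (u3 theta * lnm n)%:E) ->
  diverges_on Q (fun n theta t => t%:E).
Proof.
have [bQ _] := base; have g4 : 0 < 4^-1 * gamma by rewrite mulr_gt0.
move=> udiv M; have := udiv ((4^-1 * gamma)^-1 * M); apply: filterS => n h theta t Qt.
have := h _ _ Qt; have [_ _ -> _] := bQ _ _ _ Qt.
by rewrite !lee_fin ler_pdivrMl// mulrA.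
Qed.
End speed.

Theorem theorem9 (R : realType) (sigma theta0 rho : R) (omega : R -> R)
    (sigma_gt0 : 0 < sigma) (theta0_lt1 : theta0 < 1) (rho_gt0 : 0 < rho)
    (omega_adm : admissible omega) :
  (3 / 4 < sigma ->
   forall gamma : R, 0 < gamma -> gamma <= 1 ->
   forall Q : set_seq R, QIII_large_sigma theta0 rho gamma Q ->
     [/\ uniform_consistency_class sigma theta0 omega Q,
         poly_log_speed Q
       & diverges_on Q (fun n theta t => t%:E)]) /\
  (sigma <= 3 / 4 ->
   forall gamma gamma' : R, 0 < gamma -> gamma < 1 -> gamma < gamma' ->
   forall Q : set_seq R, QIII_small_sigma theta0 rho gamma gamma' Q ->
     uniform_consistency_class sigma theta0 omega Q /\ poly_log_speed Q).
Proof.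
split=> [s34 gamma g0 _ Q [base udiv]|_ gamma gamma' g0 _ gg' Q base].
- split.
  + apply: (uniform_consistency sigma_gt0 omega_adm g0 _ _ base) => //.
    rewrite divff ?gt_eqF//.
    rewrite (_ : (fun n => _) = moment_coef sigma); first exact: moment_coef_cvg0_large.
    by apply/funext => n; rewrite expr1n divr1.
  + exact: QIII_poly_log_speed base.
  + exact: QIII_t_diverges base udiv.
- split; last exact: QIII_poly_log_speed base.
  apply: (uniform_consistency sigma_gt0 omega_adm g0 (ltW gg') _ base).
  by apply: moment_coef_cvg0_geom => //; rewrite ltr_pdivlMr// mul1r.
Qed.
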